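(* Run the Unbiased Space Saving sketch with $m$ bins on an i.i.d. stream of items drawn from a discrete distribution with probabilities $p_1 \ge p_2 \ge \cdots$ (item $j$ drawn with probability $p_j$). If $p_1 < 1/m$, then as $t \to \infty$ the set of items labeling the bins of the sketch converges in distribution to a probability proportional to size (PPS) sample of size $m$.
   Context: Unbiased Space Saving sketch with $m$ bins: maintain $m$ bins, each an (item, count) pair, counts initialized to $0$. For each new row with item $x_{new}$: if $x_{new}$ is the label of a bin, increment its count by $1$; otherwise choose a bin with the smallest count $\hat{N}_{min}$ (uniformly at random among all bins sharing the smallest count), increment its count by $1$, and with probability $1/(\hat{N}_{min}+1)$ replace its label by $x_{new}$. A probability proportional to size (PPS) sample of size $m$ from items with sizes (here probabilities) $p_j$ is a random set of items whose marginal inclusion probabilities are proportional to the sizes; here, since $p_1<1/m$, item $j$ is included with probability $m p_j$. *)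

(* Defs.v *)
From HB Require Import structures.
From mathcomp Require Import all_boot all_order all_algebra finmap.
From mathcomp Require Import all_classical all_reals all_analysis.
Set Implicit Arguments. Unset Strict Implicit. Unset Printing Implicit Defensive.
Import Order.TTheory GRing.Theory Num.Theory.
Import numFieldNormedType.Exports.
Local Open Scope ring_scope.

(* Items are natural numbers j (item j is the paper's item j+1), drawn i.i.d.
   with probability p j.  A sketch state is a pair (labels, counts) of m bins;
   a bin label is [None] before the bin ever received a label. *)
Section USS.
Variables (R : realType) (m : nat) (p : nat -> R).

Definition uss_state := (('I_m -> option nat) * ('I_m -> nat))%type.

Definition uss_init : uss_state := (fun _ => None, fun _ => 0%N).

Definition uss_incr (c : 'I_m -> nat) (i : 'I_m) : 'I_m -> nat :=
  fun j => if j == i then (c j).+1 else c j.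

Definition uss_relabel (l : 'I_m -> option nat) (i : 'I_m) (x : nat) :
  'I_m -> option nat := fun j => if j == i then Some x else l j.

Definition uss_min_bins (c : 'I_m -> nat) : {set 'I_m} :=
  [set i | [forall j, (c i <= c j)%N]].

(* Expected value of f after one update of state s by the item x:
   if x labels a bin, that bin's count is incremented; otherwise a bin i with
   minimal count N = c i is chosen uniformly among the minimal bins, its count
   is incremented and with probability 1/(N+1) its label is replaced by x. *)
Definition uss_step_exp (f : uss_state -> R) (s : uss_state) (x : nat) : R :=
  let: (l, c) := s in
  match [pick i | l i == Some x] with
  | Some i => f (l, uss_incr c i)
  | None => \sum_(i in uss_min_bins c) (#|uss_min_bins c|%:R)^-1 *
      (((c i).+1%:R)^-1 * f (uss_relabel l i x, uss_incr c i)
       + (1 - ((c i).+1%:R)^-1) * f (l, uss_incr c i))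
  end.

(* Markov transition operator (one new i.i.d. row with item distribution p):
   (P f)(s) = E[f(S_{t+1}) | S_t = s]. *)
Definition uss_op (f : uss_state -> R) : uss_state -> R :=
  fun s => limn (series (fun x => p x * uss_step_exp f s x)).

Definition uss_labels (s : uss_state) : {fset nat} :=
  [fset x | x in pmap id [seq s.1 i | i <- enum 'I_m]]%fset.

Definition uss_prob_labels (t : nat) (A : {fset nat}) : R :=
  iter t uss_op (fun s => if uss_labels s == A then 1 else 0) uss_init.

End USS.

Definition pps_design (R : realType) (m : nat) (p : nat -> R)
  (pi : {fset nat} -> R) : Prop :=
  [/\ (forall A, 0 <= pi A),
      (\esum_(A in [set: {fset nat}]) (pi A)%:E = 1%E),
      (forall A, pi A != 0 -> #|` A| = m) &
      (forall j, \esum_(A in [set A : {fset nat} | j \in A]) (pi A)%:E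
                  = (m%:R * p j)%:E)].

(* Main.v *)
(* In time log t the label set moves slowly while the counts equilibrate fast: a bin
   with label j is credited at rate 1/m, hence receives items other than j at rate
   1/m - p_j, and such an item takes over the label with probability about m/t.  So
   the labels follow, in log time, an averaged jump chain with generator [gen].
   The drift of the deviation [dev t c i] = c_i - t/m is exactly the fluctuation
   that is averaged out, so adding a multiple of it to a test function (a corrector)
   compares the sketch between times s and t with the product of the averaged steps
   [stepK r] = 1 + gen / r, s <= r < t, up to O(1 / sqrt s).  These steps commute and
   contract the one-bin oscillation of symmetric functions by 1 - slack^2 / r;
   since the harmonic series diverges, the law of the labels is Cauchy.
   Unbiasedness of the counts identifies the limiting inclusion probabilities
   as m p_j, and gives tightness. *)
Require Import Defs.
From HB Require Import structures.
From mathcomp Require Import all_boot all_order all_algebra finmap perm.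
From mathcomp Require Import all_classical all_reals all_analysis.
From mathcomp Require Import ring lra.
Set Implicit Arguments.
Unset Strict Implicit.
Unset Printing Implicit Defensive.
Import Order.TTheory GRing.Theory Num.Theory.
Import numFieldNormedType.Exports.
Local Open Scope classical_set_scope.
Local Open Scope ring_scope.

(** The labels alone are not Markov, since the counts decide which bin may be relabelled, yet no
    stationary law of the counts is needed. The probability that bin i is credited with a fresh
    item, [qfresh l * omin c i], equals its averaged value [1/m - popt (l i)] plus the drift of the
    deviation of bin i. The corrector is therefore explicit and linear in the deviations, and only
    moments enter: the first makes the error of step r of order r^(-3/2), which is summable, and the
    fourth controls the rare times at which the minimal count, and with it the relabelling
    probability, is far from its typical size. Symmetry of the test functions matters for the
    contraction: an item can be fresh for only one of two labelings that differ in one bin, and the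
    two outcomes then agree only up to an exchange of bins. The limit law is never computed; only
    its existence and its inclusion probabilities are obtained. *)

Section Bounded.
Variables (R : realType) (T : Type).
Implicit Types f g : T -> R.

(** Standing integrability condition: an expectation is below a [limn] of partial sums, which is
    linear and monotone only where the series converges. *)
Definition bnd f := exists C, forall x, `|f x| <= C.

Lemma bnd_cst a : bnd (fun=> a).
Proof. by exists `|a|. Qed.

Lemma bndD f g : bnd f -> bnd g -> bnd (fun x => f x + g x).
Proof.
move=> [C Cf] [D Dg]; exists (C + D) => x.
by rewrite (le_trans (ler_normD _ _))// lerD.
Qed.

Lemma bndN f : bnd f -> bnd (fun x => - f x).
Proof. by move=> [C Cf]; exists C => x; rewrite normrN. Qed.

Lemma bndM f g : bnd f -> bnd g -> bnd (fun x => f x * g x).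
Proof.
move=> [C Cf] [D Dg]; exists (C * D) => x.
by rewrite normrM ler_pM.
Qed.

Lemma bnd_nat (b : T -> bool) : bnd (fun x => (b x)%:R).
Proof. by exists 1 => x; case: (b x); rewrite ?normr1 ?normr0. Qed.

Lemma bnd_comp U (f : U -> R) (k : T -> U) : (exists C, forall x, `|f x| <= C) ->
  bnd (fun x => f (k x)).
Proof. by move=> [C Cf]; exists C. Qed.

Lemma bnd_sum (I : Type) (s : seq I) (P : pred I) (F : I -> T -> R) :
  (forall i, bnd (F i)) -> bnd (fun x => \sum_(i <- s | P i) F i x).
Proof.
move=> bF; elim: s => [|i s [C Cs]].
  by exists 0 => x; rewrite big_nil normr0.
have [D Di] := bF i; exists (`|D| + C) => x; rewrite big_cons.
have D0 : 0 <= `|D| by [].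
case: ifP => _; last by rewrite (le_trans (Cs x))// lerDr.
by rewrite (le_trans (ler_normD _ _))// lerD// (le_trans (Di x))// ler_norm.
Qed.

End Bounded.
#[local] Hint Resolve bnd_cst bndD bndN bndM bnd_nat bnd_sum : core.

Ltac bounded := solve [repeat first
  [ assumption | exact: bnd_nat | exact: bnd_cst | apply: bndD | apply: bndN
  | apply: bndM | apply: bnd_sum => ? | apply: bnd_comp ]].

(** * Expectation under the item distribution *)

Section UnbiasedSpaceSaving.
Variables (R : realType) (p : nat -> R).
Hypothesis p_ge0 : forall j, 0 <= p j.
Hypothesis p_sum : series p @ \oo --> (1 : R).

Definition mean (f : nat -> R) : R := limn (series (fun x => p x * f x)).

(** An unlabelled bin behaves like a bin whose label is never drawn. *)
Definition popt (o : option nat) : R := if o is Some x then p x else 0.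

Lemma cvg_mean f : bnd f -> cvgn (series (fun x => p x * f x)).
Proof.
move=> [C Cf]; apply: normed_cvg.
apply: (@series_le_cvg _ _ (C *: p)) => [n|n|n|].
- exact: normr_ge0.
- by rewrite mulr_ge0// (le_trans _ (Cf 0%N)).
- by rewrite /= normrM ger0_norm// mulrC ler_wpM2r.
- by apply: is_cvg_seriesZ; apply: cvgP p_sum.
Qed.

Lemma meanD f g : bnd f -> bnd g -> mean (fun x => f x + g x) = mean f + mean g.
Proof.
move=> bf bg; rewrite /mean -lim_seriesD; try exact: cvg_mean.
by congr (limn (series _)); apply/funext => x; rewrite mulrDr.
Qed.

Lemma meanZ a f : bnd f -> mean (fun x => a * f x) = a * mean f.
Proof.
move=> bf; rewrite /mean -[RHS]lim_seriesZ; last exact: cvg_mean.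
by congr (limn (series _)); apply/funext => x; rewrite mulrCA.
Qed.

Lemma meanZr a f : bnd f -> mean (fun x => f x * a) = mean f * a.
Proof.
move=> bf; rewrite mulrC -meanZ//.
by congr mean; apply/funext => x; rewrite mulrC.
Qed.

Lemma meanN f : bnd f -> mean (fun x => - f x) = - mean f.
Proof.
move=> bf; rewrite -mulN1r -meanZ//.
by congr mean; apply/funext => x; rewrite mulN1r.
Qed.

Lemma meanB f g : bnd f -> bnd g -> mean (fun x => f x - g x) = mean f - mean g.
Proof. by move=> bf bg; rewrite meanD ?meanN//; exact: bndN. Qed.

Lemma mean_cst c : mean (fun=> c) = c.
Proof.
rewrite -[RHS]mulr1 -(cvg_lim _ p_sum)// -[RHS]lim_seriesZ; last exact: cvgP p_sum.
by congr (limn (series _)); apply/funext => x; rewrite mulrC.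
Qed.

Lemma le_mean f g : bnd f -> bnd g -> (forall x, f x <= g x) -> mean f <= mean g.
Proof.
move=> bf bg fg; apply: lim_series_le; try exact: cvg_mean.
by move=> x; rewrite ler_wpM2l.
Qed.

Lemma mean_sum (I : Type) (s : seq I) (P : pred I) (F : I -> nat -> R) :
  (forall i, bnd (F i)) ->
  mean (fun x => \sum_(i <- s | P i) F i x) = \sum_(i <- s | P i) mean (F i).
Proof.
move=> bF; elim: s => [|i s IH].
  rewrite big_nil -[RHS](mean_cst 0).
  by congr mean; apply/funext => x; rewrite big_nil.
rewrite big_cons -IH; case: ifP => Pi; last first.
  by congr mean; apply/funext => x; rewrite big_cons Pi.
rewrite -meanD//; last exact: bnd_sum.
by congr mean; apply/funext => x; rewrite big_cons Pi.
Qed.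

Lemma mean_norm_le f g : bnd g -> (forall x, `|f x| <= g x) -> `|mean f| <= mean g.
Proof.
move=> bg fg.
have bf : bnd f.
  have [C Cg] := bg; exists C => x.
  by rewrite (le_trans (fg x))// (le_trans (ler_norm _)).
rewrite ler_norml -meanN// !le_mean//; try exact: bndN.
  by move=> x; rewrite (le_trans _ (fg x))// ler_norm.
by move=> x; have := fg x; rewrite ler_norml => /andP[].
Qed.

Lemma mean_pt o f : mean (fun x => (o == Some x)%:R * f x) =
  if o is Some x then p x * f x else 0.
Proof.
case: o => [y|]; last first.
  rewrite -[RHS](mean_cst 0).
  by congr mean; apply/funext => x /=; rewrite mul0r.
apply: cvg_lim => //; apply: cvg_near_cst.
near=> n; rewrite seriesEnat/= (bigD1_seq y) ?iota_uniq//=; last first.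
  by rewrite mem_index_iota; near: n; exists y.+1.
rewrite eqxx mul1r big1 ?addr0// => i iy.
by rewrite (_ : Some y == Some i = false) ?mul0r ?mulr0// eq_sym; apply/eqP => -[]; apply/eqP.
Unshelve. all: by end_near. Qed.

Lemma mean_pt1 o : mean (fun x => (o == Some x)%:R) = popt o.
Proof.
under [fun x : nat => _]funext do rewrite -[(o == _)%:R]mulr1.
by rewrite mean_pt; case: o => //= x; rewrite mulr1.
Qed.

Lemma popt_ge0 o : 0 <= popt o.
Proof. by case: o => /=. Qed.

(** * The averaged label chain *)

Variable m : nat.
Hypothesis m_gt0 : (0 < m)%N.
Hypothesis p_noninc : forall j, p j.+1 <= p j.
Hypothesis p0_lt : p 0%N < (m%:R)^-1.

Local Notation labeling := ('I_m -> option nat).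
Implicit Types (l : labeling) (h : labeling -> R) (i k : 'I_m) (o : option nat).

(** Ellipticity constant of the averaged chain: it bounds from below both the weights
    [1 - m%:R * popt (l i)] and the probability of a fresh item, uniformly in the labeling. *)
Definition slack : R := 1 - m%:R * p 0%N.

Lemma mR_gt0 : 0 < m%:R :> R. Proof. by rewrite ltr0n. Qed.

Lemma slack_gt0 : 0 < slack.
Proof. by rewrite subr_gt0 mulrC -ltr_pdivlMr ?mul1r ?mR_gt0. Qed.

Lemma slack_le1 : slack <= 1.
Proof. by rewrite gerBl mulr_ge0// ler0n. Qed.

Lemma popt_le o : popt o <= p 0%N.
Proof.
case: o => [x|] //=; elim: x => // x IH.
exact: le_trans (p_noninc x) IH.
Qed.

Lemma popt_weight o : slack <= 1 - m%:R * popt o <= 1.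
Proof.
rewrite lerB ?ler_wpM2l ?popt_le ?ler0n//=.
by rewrite gerBl mulr_ge0 ?ler0n ?popt_ge0.
Qed.

(** Unlike in [uss_relabel], the new content is optional, so that bins can be erased and every
    update of one bin can be undone by another. *)
Definition upd l i o : labeling := fun j => if j == i then o else l j.

Definition fresh l x : bool := [forall i, l i != Some x].

Definition qfresh l : R := mean (fun x => (fresh l x)%:R).

Lemma freshN l x : ~~ fresh l x -> exists i, l i = Some x.
Proof. by rewrite negb_forall => /existsP[i]; rewrite negbK => /eqP; exists i. Qed.

Lemma fresh_ge l x : 1 - \sum_i (l i == Some x)%:R <= (fresh l x)%:R :> R.
Proof.
case: (boolP (fresh l x)) => [_|/freshN[i li]].
  by rewrite gerBl sumr_ge0.
by rewrite subr_le0 (bigD1 i)//= li eqxx lerDl sumr_ge0.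
Qed.

(** A union bound, since labels may be repeated here; equality for distinct labels is
    [qfresh_inj]. *)
Lemma qfresh_ge l : 1 - \sum_i popt (l i) <= qfresh l.
Proof.
rewrite -[X in X - _ <= _]mean_cst.
under eq_bigr do rewrite -mean_pt1.
rewrite -mean_sum// -meanB//; first apply: le_mean => //.
- by apply: bndD => //; apply: bndN; apply: bnd_sum.
- by move=> x; exact: fresh_ge.
- exact: bnd_sum.
Qed.

Lemma qfresh_le1 l : qfresh l <= 1.
Proof.
rewrite -[leRHS](mean_cst 1); apply: le_mean => // x.
by case: (fresh l x).
Qed.

Lemma slack_le_qfresh l : slack <= qfresh l.
Proof.
apply: le_trans (qfresh_ge l); rewrite lerB//.
rewrite (le_trans (ler_sum _ (fun i _ => popt_le (l i))))//.
by rewrite sumr_const card_ord mulr_natl.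
Qed.

Lemma qfresh_gt0 l : 0 < qfresh l.
Proof. exact: lt_le_trans slack_gt0 (slack_le_qfresh l). Qed.

Definition jump i h l : R :=
  mean (fun x => (fresh l x)%:R * (h (upd l i (Some x)) - h l)).

(** Expected change of [h] when bin i takes a label drawn from [p] conditioned on being fresh. *)
Definition gain i h l : R := jump i h l / qfresh l.

(* The averaged chain is set on all labelings, repeated and missing labels included,
   so that any two labelings are joined by changing one bin at a time. *)
Definition gen h l : R := \sum_i (1 - m%:R * popt (l i)) * gain i h l.

Definition stepK (r : nat) h l : R := h l + r%:R^-1 * gen h l.

Lemma bnd_upd l i h : bnd h -> bnd (fun x => h (upd l i (Some x))).
Proof. exact: bnd_comp. Qed.
Hint Resolve bnd_upd : core.

Lemma bnd_jump i h l : bnd h ->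
  bnd (fun x => (fresh l x)%:R * (h (upd l i (Some x)) - h l)).
Proof. by move=> bh; apply: bndM => //; apply: bndD => //; exact: bnd_upd. Qed.
Hint Resolve bnd_jump : core.

Lemma jumpE i h l : jump i h l = qfresh l * gain i h l.
Proof. by rewrite mulrC divfK// gt_eqF// qfresh_gt0. Qed.

Lemma gain_le i h l b : bnd h ->
  (forall x, fresh l x -> h (upd l i (Some x)) <= b) -> gain i h l <= b - h l.
Proof.
move=> bh hb; rewrite ler_pdivrMr ?qfresh_gt0// -meanZ//.
apply: le_mean; [bounded|bounded|move=> x]; case: (boolP (fresh l x)) => [fx|_]; last by rewrite mul0r mulr0.
by rewrite mul1r mulr1 lerB// hb.
Qed.

Lemma gainN i h l : bnd h -> gain i (fun l => - h l) l = - gain i h l.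
Proof.
move=> bh; rewrite /gain -mulNr /jump -meanN//; last exact: bnd_jump.
by congr (_ / _); congr mean; apply/funext => x; ring.
Qed.

Lemma gainD i h h' l : bnd h -> bnd h' ->
  gain i (fun l => h l + h' l) l = gain i h l + gain i h' l.
Proof.
move=> bh bh'; rewrite /gain -mulrDl /jump -meanD//; try exact: bnd_jump.
by congr (_ / _); congr mean; apply/funext => x; ring.
Qed.

Lemma gainZ i a h l : bnd h -> gain i (fun l => a * h l) l = a * gain i h l.
Proof.
move=> bh; rewrite /gain mulrA /jump -meanZ//; try exact: bnd_jump.
by congr (_ / _); congr mean; apply/funext => x; ring.
Qed.

Lemma gain_ge i h l a : bnd h ->
  (forall x, fresh l x -> a <= h (upd l i (Some x))) -> a - h l <= gain i h l.
Proof.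
move=> bh ha; rewrite -lerN2 -gainN// opprB.
rewrite -[h l]opprK addrC; apply: gain_le; first exact: bndN.
by move=> x fx; rewrite lerN2 ha.
Qed.

Lemma gain_norm_le i h l C : (forall l, `|h l| <= C) -> `|gain i h l| <= 2 * C.
Proof.
move=> hC; have bh : bnd h by exists C.
have := hC l; rewrite !ler_norml => /andP[hl1 hl2].
have hx l1 : - C <= h l1 <= C by rewrite -ler_norml.
have g1 := gain_le (b := C) (i := i) (l := l) bh (fun x _ => proj2 (andP (hx _))).
have g2 := gain_ge (a := - C) (i := i) (l := l) bh (fun x _ => proj1 (andP (hx _))).
by apply/andP; split; lra.
Qed.

Lemma gen_norm_le h l C : (forall l, `|h l| <= C) -> `|gen h l| <= m%:R * (2 * C).
Proof.
move=> hC; rewrite (le_trans (ler_norm_sum _ _ _))//.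
apply: (@le_trans _ _ (\sum_(i < m) (2 * C))); last first.
  by rewrite sumr_const card_ord -[_ *+ m]mulr_natl.
apply: ler_sum => i _.
have /andP[w0 w1] := popt_weight (l i).
rewrite normrM ger0_norm ?(le_trans (ltW slack_gt0))//.
by rewrite -[leRHS]mul1r ler_pM// ?(le_trans (ltW slack_gt0))// gain_norm_le.
Qed.

Lemma bnd_gen h : bnd h -> bnd (gen h).
Proof. by move=> [C hC]; exists (m%:R * (2 * C)) => l; exact: gen_norm_le. Qed.

Lemma genD h h' l : bnd h -> bnd h' ->
  gen (fun l => h l + h' l) l = gen h l + gen h' l.
Proof.
move=> bh bh'; rewrite /gen -big_split/=; apply: eq_bigr => i _.
by rewrite gainD// mulrDr.
Qed.

Lemma genZ a h l : bnd h -> gen (fun l => a * h l) l = a * gen h l.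
Proof.
move=> bh; rewrite /gen mulr_sumr; apply: eq_bigr => i _.
by rewrite gainZ// mulrCA.
Qed.

Lemma bnd_stepK r h : bnd h -> bnd (stepK r h).
Proof. by move=> bh; apply: bndD => //; apply: bndM => //; exact: bnd_gen. Qed.

Lemma stepKC r s h : bnd h -> stepK r (stepK s h) = stepK s (stepK r h).
Proof.
move=> bh; apply/funext => l; rewrite /stepK.
have bg := bnd_gen bh.
by rewrite !genD ?genZ//; [ring| |]; apply: bndM.
Qed.

(** The jump rates in [gen] add up to at most m, so for r >= m the step is an averaging operator and
    obeys a maximum principle. *)
Lemma stepK_le r h b : (m <= r)%N -> bnd h -> (forall l, h l <= b) ->
  forall l, stepK r h l <= b.
Proof.
move=> mr bh hb l; have r0 : 0 < r%:R :> R by rewrite ltr0n (leq_trans m_gt0).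
suff gb : gen h l <= r%:R * (b - h l).
  by rewrite /stepK -lerBrDl mulrC ler_pdivrMr// mulrC.
apply: (@le_trans _ _ (\sum_(i < m) (b - h l))); last first.
  rewrite sumr_const card_ord -[_ *+ m]mulr_natl ler_wpM2r ?ler_nat//.
  by rewrite subr_ge0.
apply: ler_sum => i _; have /andP[w0 w1] := popt_weight (l i).
have w00 : 0 <= 1 - m%:R * popt (l i) by rewrite (le_trans (ltW slack_gt0)).
rewrite (le_trans (ler_wpM2l w00 (gain_le (b := b) bh (fun x _ => hb _))))//.
by rewrite -[leRHS]mul1r ler_wpM2r// subr_ge0.
Qed.

Lemma stepKN r h l : bnd h -> stepK r (fun l => - h l) l = - stepK r h l.
Proof.
move=> bh; rewrite /stepK.
have -> : (fun l => - h l) = (fun l => -1 * h l).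
  by apply/funext => l'; rewrite mulN1r.
by rewrite genZ//; ring.
Qed.

Lemma stepK_ge r h a : (m <= r)%N -> bnd h -> (forall l, a <= h l) ->
  forall l, a <= stepK r h l.
Proof.
move=> mr bh ha l; rewrite -lerN2 -stepKN//.
by apply: stepK_le => // [|l']; [exact: bndN|rewrite lerN2].
Qed.

Fixpoint iterK (s n : nat) h : labeling -> R :=
  if n is n'.+1 then stepK s (iterK s.+1 n' h) else h.

Lemma bnd_iterK s n h : bnd h -> bnd (iterK s n h).
Proof. by elim: n s => //= n IH s bh; apply: bnd_stepK; exact: IH. Qed.

(* Adding a factor at the far end is the same as adding it in front, because the
   factors commute; hence later products average earlier ones. *)
Lemma iterKSr s n h : bnd h -> iterK s n.+1 h = stepK (s + n) (iterK s n h).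
Proof.
move=> bh; elim: n s => [|n IH] s; first by rewrite addn0.
rewrite -[LHS]/(stepK s (iterK s.+1 n.+1 h)) IH addSnnS stepKC//.
exact: bnd_iterK.
Qed.

Lemma iterK_norm_le s n h C : (m <= s)%N -> (forall l, `|h l| <= C) ->
  forall l, `|iterK s n h l| <= C.
Proof.
elim: n s => //= n IH s ms hC l.
have bh : bnd h by exists C.
have hC' : forall l, - C <= iterK s.+1 n h l <= C.
  by move=> l'; rewrite -ler_norml IH// ltnW.
have bK := bnd_iterK s.+1 n bh.
rewrite ler_norml; apply/andP; split.
- by apply: stepK_ge => // l'; case/andP: (hC' l').
- by apply: stepK_le => // l'; case/andP: (hC' l').
Qed.

Lemma iterK_osc s n n' h e : (m <= s)%N -> bnd h ->
  (forall l l', iterK s n h l - iterK s n h l' <= e) ->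
  forall l, `|iterK s (n + n') h l - iterK s n h l| <= e.
Proof.
move=> ms bh osc l0; set c := iterK s n h l0.
(* The interval of radius e around the value at [l0] contains all values at stage n, and further
   averaging steps cannot leave it. *)
suff /(_ l0) : forall l, c - e <= iterK s (n + n') h l <= c + e.
  by move=> /andP[? ?]; rewrite ler_norml; apply/andP; split; lra.
elim: n' => [|n' IH] l.
  rewrite addn0; have := osc l l0; have := osc l0 l.
  by rewrite -/c => ? ?; apply/andP; split; lra.
rewrite addnS iterKSr//.
have ms' : (m <= s + (n + n'))%N by rewrite (leq_trans ms)// leq_addr.
have bK := bnd_iterK s (n + n') bh.
apply/andP; split.
- by apply: stepK_ge => // l'; case/andP: (IH l').
- by apply: stepK_le => // l'; case/andP: (IH l').
Qed.

(** * Contraction of the one-bin oscillation *)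

Definition sym h := forall (s : {perm 'I_m}) l, h (fun i => l (s i)) = h l.

(** One-sided bounds suffice, because the two labelings exchange roles when bin k gets its old
    content back. *)
Definition lip h (D : R) := forall l k o, h l - h (upd l k o) <= D.

Lemma upd_id l i : upd l i (l i) = l.
Proof. by apply/funext => j; rewrite /upd; case: eqVneq => [->|]. Qed.

Lemma upd_upd l i o o' : upd (upd l i o) i o' = upd l i o'.
Proof. by apply/funext => j; rewrite /upd; case: eqVneq. Qed.

Lemma updC l i k o o' : i != k -> upd (upd l i o) k o' = upd (upd l k o') i o.
Proof.
move=> ik; apply/funext => j; rewrite /upd.
by case: (eqVneq j k) => // ->; rewrite eq_sym (negPf ik).
Qed.

Lemma sym_swap h l i k o o' : sym h -> i != k ->
  h (upd (upd l i o) k o') = h (upd (upd l i o') k o).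
Proof.
move=> sh ik; rewrite -[LHS](sh (tperm i k)); congr h; apply/funext => j.
rewrite /upd; case: tpermP => [->|->|/eqP/negPf ji /eqP/negPf jk].
- by rewrite !eqxx (negPf ik).
- by rewrite (negPf ik) !eqxx.
- by rewrite ji jk.
Qed.

Lemma fresh_perm (s : {perm 'I_m}) l x : fresh (fun i => l (s i)) x = fresh l x.
Proof.
apply/forallP/forallP => [f i|f i]; last exact: f.
by have := f (s^-1%g i); rewrite permKV.
Qed.

Lemma sym_stepK r h : sym h -> sym (stepK r h).
Proof.
move=> sh s l; rewrite /stepK sh; congr (_ + _ * _).
rewrite /gen [RHS](reindex_inj (@perm_inj _ s))/=; apply: eq_bigr => i _.
congr (_ * (_ / _)); last first.
  by congr mean; apply/funext => x; rewrite fresh_perm.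
congr mean; apply/funext => x; rewrite fresh_perm sh; congr (_ * (_ - _)).
rewrite -[RHS](sh s); congr h; apply/funext => j.
by rewrite /upd (inj_eq (@perm_inj _ s)).
Qed.

Lemma sym_iterK s n h : sym h -> sym (iterK s n h).
Proof. by elim: n s => //= n IH s sh; apply: sym_stepK; exact: IH. Qed.

Lemma lip_ge0 h D (l : labeling) k : lip h D -> 0 <= D.
Proof. by move=> /(_ l k (l k)); rewrite upd_id subrr. Qed.

Lemma fresh_updP l k o x :
  fresh (upd l k o) x = [forall i, (i == k) || (l i != Some x)] && (o != Some x).
Proof.
apply/forallP/andP => [f|[/forallP f ox] i].
  split; last by have := f k; rewrite /upd eqxx.
  by apply/forallP => i; have := f i; rewrite /upd; case: (eqVneq i k).
by have := f i; rewrite /upd; case: (eqVneq i k).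
Qed.

(* Two labelings that differ in bin k only, with labels a and b: when bin i is
   relabeled in both, the pair (x, b) versus (x, a) is coupled through x; the
   configurations with i relabeled to b, resp. a, agree up to a swap of i and k. *)
Lemma gain_other h D l i k b : bnd h -> sym h -> lip h D -> i != k ->
  gain i h l - gain i h (upd l k b) <= D - (h l - h (upd l k b)).
Proof.
move=> bh sh lh ik; set l' := upd l k b.
have D0 := lip_ge0 l k lh.
pose z := h (upd l i b).
have zE : z = h (upd l' i (l k)).
  rewrite /l' (updC _ _ _ (_ : k != i)) 1?eq_sym// sym_swap// -/z.
  by rewrite (updC _ _ _ ik) upd_id.
(* Items fresh for only one of the two labelings lead to the common value [z]. Measuring all values
   from [z] leaves only the items fresh for both. *)
pose both x := fresh l x && fresh l' x.
have gE l1 : (forall x, fresh l1 x -> ~~ both x -> h (upd l1 i (Some x)) = z) ->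
    (forall x, both x -> fresh l1 x) ->
    gain i h l1 = z - h l1 + mean (fun x => (both x)%:R *
      (h (upd l1 i (Some x)) - z)) / qfresh l1.
  move=> h1 h2; apply: (canRL (addNKr _)); rewrite opprB /gain.
  rewrite -[h l1 - z](@mulfK _ (qfresh l1)) ?gt_eqF ?qfresh_gt0//.
  rewrite -mulrDl /qfresh /jump -meanZ// -meanD; try bounded.
  congr (_ / _); congr mean; apply/funext => x.
  case: (boolP (both x)) => [bx|nbx]; first by rewrite h2 //=; ring.
  case: (boolP (fresh l1 x)) => [fx|_]; last by rewrite mulr0 !mul0r addr0.
  by rewrite (h1 x fx nbx) /=; ring.
rewrite (gE l) ?(gE l'); first last.
- by move=> x /andP[].
- move=> x fx; rewrite /both fx /= /l' fresh_updP.
  have := fx; rewrite -{1}(upd_id l k) fresh_updP => /andP[-> _] /=.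
  by rewrite negbK => /eqP <-.
- by move=> x /andP[].
- move=> x fx; rewrite /both fx andbT -{1}(upd_id l k) fresh_updP.
  have := fx; rewrite /l' fresh_updP => /andP[-> _] /=.
  by rewrite negbK zE => /eqP ->.
set v := fun x => h (upd l i (Some x)).
set w := fun x => h (upd l' i (Some x)).
have vw x : v x - w x <= D by rewrite /v /w /l' -(updC _ _ _ ik); exact: lh.
have vz x : v x - z <= D.
  by have := lh (upd l i (Some x)) i b; rewrite upd_upd.
have zw x : z - w x <= D.
  by have := lh (upd l' i (l k)) i (Some x); rewrite upd_upd zE.
have q1 := qfresh_gt0 l; have q2 := qfresh_gt0 l'.
have i1 : 0 < (qfresh l)^-1 by rewrite invr_gt0.
have i2 : 0 < (qfresh l')^-1 by rewrite invr_gt0.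
pose q12 := mean (fun x => (both x)%:R).
have q12l : q12 <= qfresh l.
  by apply: le_mean => // x; rewrite /both; case: (fresh l x); case: (fresh l' x).
have q12l' : q12 <= qfresh l'.
  by apply: le_mean => // x; rewrite /both; case: (fresh l x); case: (fresh l' x).
suff : mean (fun x => (both x)%:R * (v x - z)) / qfresh l
     - mean (fun x => (both x)%:R * (w x - z)) / qfresh l' <= D by lra.
have bv : bnd v by exact: bnd_upd.
have bw : bnd w by exact: bnd_upd.
rewrite ![_ / qfresh _]mulrC -!meanZ -?meanB; try bounded.
(* The two conditional laws have different normalizations. The smaller of the inverses pairs [v]
   with [w]; the excess of the larger one is paired with [z]. *)
have [qq|/ltW qq] := leP (qfresh l) (qfresh l').
- have ii : (qfresh l')^-1 <= (qfresh l)^-1 by rewrite lef_pV2.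
  apply: (@le_trans _ _ (mean (fun x => ((qfresh l)^-1 * D) * (both x)%:R))).
    apply: le_mean; [bounded|bounded|move=> x].
    case: (both x); rewrite ?mul0r ?mulr0 ?subrr// !mul1r mulr1.
    by have := vw x; have := vz x; have := zw x; nra.
  by rewrite meanZ// -/q12 mulrAC ler_piMl// ler_pdivrMl ?mulr1.
- have ii : (qfresh l)^-1 <= (qfresh l')^-1 by rewrite lef_pV2.
  apply: (@le_trans _ _ (mean (fun x => ((qfresh l')^-1 * D) * (both x)%:R))).
    apply: le_mean; [bounded|bounded|move=> x].
    case: (both x); rewrite ?mul0r ?mulr0 ?subrr// !mul1r mulr1.
    by have := vw x; have := vz x; have := zw x; nra.
  by rewrite meanZ// -/q12 mulrAC ler_piMl// ler_pdivrMl ?mulr1.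
Qed.

(** The contraction comes from bin k: once it takes the same new label in both labelings, they
    coincide. The weights on the two sides differ, which costs a multiple of D - d, with d the
    current difference; this vanishes for a pair that attains the bound D. *)
Lemma gain_same h D l k b : bnd h -> lip h D ->
  (1 - m%:R * popt (l k)) * gain k h l
    - (1 - m%:R * popt b) * gain k h (upd l k b)
  <= (2 / slack + 1) * (D - (h l - h (upd l k b)))
     - slack ^+ 2 * (h l - h (upd l k b)).
Proof.
move=> bh lh; set l' := upd l k b; have D0 := lip_ge0 l k lh.
have s0 := slack_gt0; have s1 := slack_le1.
pose B x := [forall i, (i == k) || (l i != Some x)].
pose u x := h (upd l k (Some x)).
have bu : bnd u by exact: bnd_upd.
have gE o : gain k h (upd l k o) = (qfresh (upd l k o))^-1 *
    mean (fun x => (B x)%:R * (u x - h (upd l k o))).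
  rewrite mulrC; congr (_ / _); congr mean; apply/funext => x.
  rewrite upd_upd fresh_updP -/(B x); case: (B x) => /=; last by rewrite !mul0r.
  (* An item equal to the content of bin k changes nothing when written there, so both means can run
     over the same items [B]. *)
  by case: eqVneq => [->|_ //=]; rewrite /u subrr !mulr0.
rewrite -[in gain k h l](upd_id l k) !gE upd_id -/l' !mulrA.
have /andP[a0 a1] := popt_weight (l k); have /andP[b0 b1] := popt_weight b.
have hA c l1 : slack <= c <= 1 -> slack <= c / qfresh l1 <= slack^-1.
  move=> /andP[c0 c1]; have q0 := qfresh_gt0 l1; apply/andP; split.
    rewrite ler_pdivlMr// (le_trans _ c0)// ler_piMr ?qfresh_le1//.
    exact: ltW.
  rewrite ler_pdivrMr// (le_trans c1)// mulrC ler_pdivlMr// mul1r.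
  exact: slack_le_qfresh.
have /andP[A0 A1] := hA _ l (popt_weight (l k)).
have /andP[B0 B1] := hA _ l' (popt_weight b).
move: A0 A1 B0 B1; set A := _ / qfresh l; set A' := _ / qfresh l'.
move=> A0 A1 B0 B1; set d := h l - h l'.
pose qB := mean (fun x => (B x)%:R).
have qB1 : qB <= 1.
  by rewrite -[leRHS](mean_cst 1); apply: le_mean => // x; case: (B x).
have qB0 : slack <= qB.
  apply: le_trans (slack_le_qfresh l) _; apply: le_mean => // x.
  by rewrite -{1}(upd_id l k) fresh_updP -/(B x); case: (B x); case: (_ != _).
have dD : d <= D by exact: lh.
have dD' : - d <= D.
  by have := lh l' k (l k); rewrite /l' upd_upd upd_id opprB.
have iV : 0 < slack^-1 by rewrite invr_gt0.
(* The numbers u x - h l and h l' - u x are both at most D - d and add up to -d. Taking out the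
   common part [slack] of their weights A and A' leaves the bound. *)
apply: (@le_trans _ _ (mean (fun x => ((A + A') * (D - d) - slack * d) * (B x)%:R))).
  rewrite -!meanZ -?meanB; try bounded.
  apply: le_mean; [bounded|bounded|move=> x].
  case: (B x); rewrite ?mul0r ?mulr0 ?subrr// !mul1r mulr1.
  have ul : h l' - u x <= D by have := lh l' k (Some x); rewrite upd_upd.
  have ul' : u x - h l' <= D by have := lh (upd l k (Some x)) k b; rewrite upd_upd.
  have hl : h l - u x <= D by exact: lh.
  by rewrite /d in dD dD' *; nra.
rewrite meanZ// -/qB.
have t1 : (A + A') * (D - d) * qB <= 2 / slack * (D - d).
  have : 0 <= (A + A') * (D - d) by rewrite mulr_ge0; lra.
  move=> h1; rewrite (le_trans (ler_piMr h1 qB1))// ler_wpM2r ?subr_ge0//; lra.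
(* d may be negative. With e = slack (qB - slack), which lies in [0, 1], the claim is that e D + (1
   - e)(D - d) >= 0. *)
have t2 : - (slack * d) * qB <= (D - d) - slack ^+ 2 * d.
  have qs : 0 <= qB - slack by lra.
  have qs1 : qB - slack <= 1 by lra.
  have e0 := mulr_ge0 (ltW s0) qs.
  have e1 := ler_pM (ltW s0) qs s1 qs1.
  have := mulr_ge0 e0 D0; have dD0 : 0 <= D - d by lra.
  have e10 : 0 <= 1 - slack * (qB - slack) by lra.
  by have := mulr_ge0 e10 dD0; lra.
by lra.
Qed.

(** Chosen so that r - slack^2 dominates the coefficient m + 2/slack + 1 of D - d in [lip_stepK];
    those terms are then absorbed. *)
Definition rate_bound : R := m%:R + 2 / slack + 2.

Lemma lip_stepK r h D : bnd h -> sym h -> lip h D -> rate_bound <= r%:R ->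
  lip (stepK r h) ((1 - slack ^+ 2 / r%:R) * D).
Proof.
move=> bh sh lh rb l k b; set l' := upd l k b; have D0 := lip_ge0 l k lh.
have s0 := slack_gt0; have s1 := slack_le1.
have iV : 0 < slack^-1 by rewrite invr_gt0.
have r0 : 0 < r%:R :> R.
  by rewrite (lt_le_trans _ rb)// /rate_bound; have := mR_gt0; lra.
set d := h l - h l'; have dD : d <= D by exact: lh.
have gd : gen h l - gen h l' <=
    (m%:R + 2 / slack + 1) * (D - d) - slack ^+ 2 * d.
  rewrite /gen (bigD1 k)//= [X in _ - X](bigD1 k)//=.
  have := gain_same l k b bh lh.
  have -> : l' k = b by rewrite /l' /upd eqxx.
  rewrite -/l' -/d => gs.
  suff : \sum_(i < m | i != k) (1 - m%:R * popt (l i)) * gain i h l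
     - \sum_(i < m | i != k) (1 - m%:R * popt (l' i)) * gain i h l'
     <= m%:R * (D - d) by lra.
  rewrite -sumrB; apply: (@le_trans _ _ (\sum_(i < m | i != k) (D - d))).
    apply: ler_sum => i ik; have /andP[w0 w1] := popt_weight (l i).
    have -> : l' i = l i by rewrite /l' /upd (negPf ik).
    rewrite -mulrBr.
    have go := gain_other l b bh sh lh ik.
    have w00 : 0 <= 1 - m%:R * popt (l i) by lra.
    rewrite (le_trans (ler_wpM2l w00 go))// ler_piMl// subr_ge0//.
  rewrite sumr_const -[_ *+ _]mulr_natl ler_wpM2r ?subr_ge0// ler_nat.
  by rewrite -[leqRHS]card_ord max_card.
rewrite /stepK -/l'.
have -> : h l + r%:R^-1 * gen h l - (h l' + r%:R^-1 * gen h l') =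
  d + r%:R^-1 * (gen h l - gen h l') by rewrite /d; ring.
rewrite -(ler_pM2l r0) mulrDr mulrA divff ?gt_eqF// mul1r.
have -> : r%:R * ((1 - slack ^+ 2 / r%:R) * D) = (r%:R - slack ^+ 2) * D.
  by field; rewrite gt_eqF.
have s2 : slack ^+ 2 <= 1 by rewrite exprn_ile1// ltW.
by rewrite /rate_bound in rb; nra.
Qed.

Lemma lip_osc h D : lip h D -> forall l l', h l - h l' <= m%:R * D.
Proof.
move=> lh l l'; pose mix (n : nat) : labeling := fun i => if (i < n)%N then l' i else l i.
suff H n : (n <= m)%N -> h l - h (mix n) <= n%:R * D.
  have := H m (leqnn m); rewrite (_ : mix m = l')//.
  by apply/funext => i; rewrite /mix ltn_ord.
elim: n => [|n IH] nm.
  by rewrite mul0r subr_le0 (_ : mix 0%N = l).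
have -> : mix n.+1 = upd (mix n) (Ordinal nm) (l' (Ordinal nm)).
  apply/funext => i; rewrite /upd /mix -val_eqE/= ltnS leq_eqVlt.
  by case: eqVneq => //= ein; congr l'; apply: val_inj.
have := lh (mix n) (Ordinal nm) (l' (Ordinal nm)); have := IH (ltnW nm).
by rewrite -[n.+1]addn1 natrD; lra.
Qed.

Lemma norm_lip h C : (forall l, `|h l| <= C) -> lip h (2 * C).
Proof.
move=> hC l k o; have := hC l; have := hC (upd l k o).
by rewrite !ler_norml => /andP[? ?] /andP[? ?]; lra.
Qed.

(** The product of the factors 1 - y_i is bounded by the inverse of 1 + sum y_i, using (1 - y)(Y +
    y) <= Y for Y >= 1. Divergence of the sum then suffices, without exponentials. *)
Lemma lip_iterK s n h D : bnd h -> sym h -> lip h D -> rate_bound <= s%:R ->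
  lip (iterK s n h) (D / (1 + slack ^+ 2 * \sum_(i < n) ((s + i)%:R)^-1)).
Proof.
move=> bh sh lh rb; elim: n => [|n IH].
  by rewrite big_ord0 mulr0 addr0 divr1.
have D0 := lip_ge0 (fun=> None) (Ordinal m_gt0) lh.
have rb' : rate_bound <= (s + n)%:R by rewrite (le_trans rb)// ler_nat leq_addr.
rewrite iterKSr// => l k o.
have := lip_stepK (bnd_iterK s n bh) (sym_iterK s n sh) IH rb' l k o.
move=> /le_trans; apply; rewrite big_ord_recr/= mulrDr addrA.
have V0 : 0 <= slack ^+ 2 / (s + n)%:R by rewrite divr_ge0 ?sqr_ge0.
set Y := 1 + slack ^+ 2 * _; set y := slack ^+ 2 / _ in V0 *.
have Y1 : 1 <= Y by rewrite /Y lerDl mulr_ge0 ?sqr_ge0// sumr_ge0// => i _; rewrite invr_ge0.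
have Y0 : 0 < Y by lra.
have Yy : 0 < Y + y by lra.
rewrite ler_pdivlMr// [X in X <= _](_ : _ = D * ((1 - y) * (Y + y) / Y)); last first.
  by field; rewrite gt_eqF.
rewrite ler_piMr// ler_pdivrMr// mul1r; nra.
Qed.

Lemma harmonic_unbounded (s : nat) (M : R) : (0 < s)%N ->
  exists n, M <= \sum_(i < n) ((s + i)%:R)^-1.
Proof.
case: s => // s _; apply: contrapT => /forallNP H.
apply: (@dvg_harmonic R).
have hi i : 0 <= (harmonic i : R) by exact: harmonic_ge0.
apply: nondecreasing_is_cvgn.
  by apply/nondecreasing_seqP => n; rewrite !seriesEnat/= big_nat_recr//= lerDl.
exists (M + series harmonic s) => _ [n _ <-].
apply: (@le_trans _ _ (series (@harmonic R) (s + n)%N)).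
  rewrite !seriesEnat/= [leRHS](@big_cat_nat _ _ _ n)//=; last exact: leq_addl.
  by rewrite lerDl sumr_ge0.
rewrite !seriesEnat/= [leLHS](@big_cat_nat _ _ _ s)//=; last exact: leq_addr.
rewrite addrC lerD2r; have := H n; move/negP; rewrite -ltNge => /ltW.
apply: le_trans; rewrite -{1}[s]add0n [(s + n)%N]addnC big_addn addnK big_mkord.
by apply: ler_sum => i _; rewrite /harmonic/= addSn addnC.
Qed.

Lemma iterK_mixing s h e : bnd h -> sym h -> rate_bound <= s%:R -> 0 < e ->
  exists n, forall l l', iterK s n h l - iterK s n h l' <= e.
Proof.
move=> bh sh rb e0; have [C hC] := bh; have lh := norm_lip hC.
have D0 := lip_ge0 (fun=> None) (Ordinal m_gt0) lh.
have s2 : 0 < slack ^+ 2 by rewrite exprn_gt0// slack_gt0.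
have iV : 0 < slack^-1 by rewrite invr_gt0 slack_gt0.
have s0 : (0 < s)%N.
  by rewrite -(ltr0n R) (lt_le_trans _ rb)// /rate_bound; have := mR_gt0; lra.
have [n nM] := harmonic_unbounded (m%:R * (2 * C) / e / slack ^+ 2) s0.
exists n => l l'.
rewrite (le_trans (lip_osc (lip_iterK n bh sh lh rb) l l'))// mulrA.
set S := \sum_(i < n) _ in nM *.
have SM : m%:R * (2 * C) / e <= slack ^+ 2 * S by rewrite [leRHS]mulrC -ler_pdivrMr.
have M0 : 0 <= m%:R * (2 * C) / e.
  by apply: divr_ge0; [exact: mulr_ge0|exact: ltW].
have S0 : 0 < 1 + slack ^+ 2 * S by lra.
rewrite ler_pdivrMr//.
by rewrite [leRHS]mulrC -ler_pdivrMr//; lra.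
Qed.

(** * The sketch as a Markov chain *)

Implicit Types (c : 'I_m -> nat) (f g : uss_state m -> R) (t : nat).

Definition inj_labels l := forall i j x, l i = Some x -> l j = Some x -> i = j.

(** Count moments are unbounded, but one step from given counts reaches only finitely many count
    vectors; only the labels range over an infinite set. *)
Definition lbnd f := forall c, bnd (fun l => f (l, c)).

(* The share of the fresh items credited to bin i. *)
Definition omin c i : R := (i \in uss_min_bins c)%:R / #|uss_min_bins c|%:R.

(* The probability that the next row increments bin i. *)
Definition rate l c i : R := popt (l i) + qfresh l * omin c i.

Definition inv_count c i : R := ((c i).+1%:R)^-1.

Lemma inv_count_gt0 c i : 0 < inv_count c i.
Proof. by rewrite invr_gt0 ltr0n. Qed.

Lemma inv_count_le1 c i : inv_count c i <= 1.
Proof. by rewrite invf_le1 ?ltr0n// ler1n. Qed.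

Lemma min_binP c i : reflect (forall j, (c i <= c j)%N) (i \in uss_min_bins c).
Proof. by rewrite inE; exact: forallP. Qed.

Lemma min_bin_ex c : exists i, i \in uss_min_bins c.
Proof.
case: (@arg_minnP _ (Ordinal m_gt0) xpredT c isT) => i _ ci.
by exists i; apply/min_binP => j; exact: ci.
Qed.

Lemma card_min_bins_gt0 c : 0 < #|uss_min_bins c|%:R :> R.
Proof. by rewrite ltr0n card_gt0; apply/set0Pn; exact: min_bin_ex. Qed.

Lemma omin_ge0 c i : 0 <= omin c i.
Proof. by rewrite divr_ge0. Qed.

Lemma sum_omin c : \sum_i omin c i = 1.
Proof.
rewrite -mulr_suml -natr_sum -big_mkcond/= sum1_card divff//.
by rewrite gt_eqF// card_min_bins_gt0.
Qed.

Lemma rate_ge0 l c i : 0 <= rate l c i.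
Proof. by rewrite addr_ge0 ?popt_ge0// mulr_ge0 ?omin_ge0// ltW// qfresh_gt0. Qed.

Lemma fresh_inj l x : inj_labels l ->
  (fresh l x)%:R = 1 - \sum_i (l i == Some x)%:R :> R.
Proof.
move=> il; case: (boolP (fresh l x)) => [/forallP fx|/freshN[i li]].
  by rewrite big1 ?subr0// => i _; rewrite (negPf (fx i)).
rewrite (bigD1 i)//= li eqxx big1 ?addr0 ?subrr// => j ji.
by case: eqP => // lj; rewrite (il _ _ _ lj li) eqxx in ji.
Qed.

Lemma qfresh_inj l : inj_labels l -> qfresh l = 1 - \sum_i popt (l i).
Proof.
move=> il; rewrite -[X in X - _]mean_cst.
under eq_bigr do rewrite -mean_pt1.
rewrite -mean_sum// -meanB//; last exact: bnd_sum.
by congr mean; apply/funext => x; rewrite fresh_inj.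
Qed.

Lemma sum_rate l c : inj_labels l -> \sum_i rate l c i = 1.
Proof.
move=> il; rewrite big_split/= -mulr_sumr sum_omin mulr1 qfresh_inj//.
by rewrite addrC subrK.
Qed.

(** Distinct labels turn the choice made by [pick] into a sum of indicators. Writing a relabelling
    as a correction to the unchanged labels isolates the jumps. *)
Lemma step_inj f l c x : inj_labels l ->
  uss_step_exp f (l, c) x =
  \sum_i (l i == Some x)%:R * f (l, uss_incr c i) +
  \sum_i omin c i * ((fresh l x)%:R * f (l, uss_incr c i) +
    inv_count c i * ((fresh l x)%:R *
      (f (upd l i (Some x), uss_incr c i) - f (l, uss_incr c i)))).
Proof.
move=> il; rewrite /uss_step_exp; case: pickP => [i /eqP li|nl].
  have -> : fresh l x = false by apply/negbTE/forallPn; exists i; rewrite negbK li.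
  rewrite [X in _ + X]big1 => [|j _]; last by rewrite !mul0r mulr0 addr0 mulr0.
  rewrite (bigD1 i)//= li eqxx mul1r big1 ?addr0// => j ji.
  case: eqP => [lj|_]; last by rewrite mul0r.
  by rewrite (il _ _ _ lj li) eqxx in ji.
have -> : fresh l x by apply/forallP => i; rewrite nl.
rewrite [X in _ = X + _]big1 ?add0r => [|i _]; last by rewrite nl mul0r.
rewrite big_mkcond; apply: eq_bigr => i _; rewrite /omin.
case: (i \in _); last by rewrite !mul0r.
by rewrite /inv_count /upd /uss_relabel /=; ring.
Qed.

Lemma lbnd_upd f l c i : lbnd f -> bnd (fun x => f (upd l i (Some x), c)).
Proof. by move=> /(_ c)[C fC]; exists C. Qed.

Lemma uss_opE f s : uss_op p f s = mean (uss_step_exp f s).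
Proof. by []. Qed.

Lemma uss_op_inj f l c : lbnd f -> inj_labels l ->
  uss_op p f (l, c) =
  \sum_i rate l c i * f (l, uss_incr c i) +
  \sum_i omin c i * (inv_count c i * jump i (fun l => f (l, uss_incr c i)) l).
Proof.
move=> bf il; rewrite uss_opE (funext (fun x => step_inj f c x il)).
have b1 i : bnd (fun x => f (upd l i (Some x), uss_incr c i)) by exact: lbnd_upd.
rewrite meanD; [|by apply: bnd_sum => i; bounded|]; last first.
  by apply: bnd_sum => i; have := b1 i => b1i; bounded.
rewrite !mean_sum; [|by move=> i; have := b1 i => b1i; bounded|by move=> i; bounded].
rewrite -!big_split/=; apply: eq_bigr => i _; have := b1 i => b1i.
rewrite meanZ; last by bounded.
rewrite meanD; [|bounded|bounded].
rewrite !meanZr// meanZ; last by bounded.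
by rewrite mean_pt1 -/(qfresh l) /rate /jump; ring.
Qed.

Lemma uss_step_bnd f c : lbnd f ->
  exists C, forall l x, `|uss_step_exp f (l, c) x| <= C.
Proof.
move=> bf; have /choice[C fC] : forall i, exists C, forall l, `|f (l, uss_incr c i)| <= C.
  by move=> i; exact: bf.
have C0 i : 0 <= C i by rewrite (le_trans _ (fC i (fun=> None))).
exists (\sum_i C i) => l x; rewrite /uss_step_exp; case: pickP => [i _|_].
  by rewrite (le_trans (fC i l))// (bigD1 i)//= lerDl sumr_ge0.
rewrite (le_trans (ler_norm_sum _ _ _))// [leRHS](bigID (mem (uss_min_bins c)))/=.
rewrite -[leLHS]addr0 lerD ?sumr_ge0// ler_sum// => i iM.
have k1 : (#|uss_min_bins c|%:R)^-1 <= 1 :> R.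
  by rewrite invf_le1 ?card_min_bins_gt0// ler1n card_gt0; apply/set0Pn; exists i.
have k0 : 0 <= (#|uss_min_bins c|%:R)^-1 :> R by [].
have := fC i l; have := fC i (uss_relabel l i x).
have := inv_count_gt0 c i; have := inv_count_le1 c i; rewrite /inv_count.
set a := _^-1; set y := f _; set z := f _ => a1 a0 yC zC.
rewrite normrM (ger0_norm k0) -[leRHS]mul1r ler_pM//.
rewrite (le_trans (ler_normD _ _))// !normrM.
have a1' : 0 <= 1 - a by rewrite subr_ge0.
rewrite (ger0_norm (ltW a0)) (ger0_norm a1').
by have := ler_wpM2l (ltW a0) yC; have := ler_wpM2l a1' zC; lra.
Qed.

Lemma bnd_step f s : lbnd f -> bnd (uss_step_exp f s).
Proof. by case: s => l c /(@uss_step_bnd f c)[C fC]; exists C. Qed.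

Lemma lbnd_op f : lbnd f -> lbnd (uss_op p f).
Proof.
move=> bf c; have [C fC] := uss_step_bnd c bf; exists C => l.
by rewrite -[leRHS](mean_cst C); apply: mean_norm_le.
Qed.

Lemma lbndD f g : lbnd f -> lbnd g -> lbnd (fun s => f s + g s).
Proof. by move=> bf bg c; apply: bndD. Qed.

Lemma lbndZ a f : lbnd f -> lbnd (fun s => a * f s).
Proof. by move=> bf c; apply: bndM. Qed.

Lemma lbnd_iter t f : lbnd f -> lbnd (iter t (uss_op p) f).
Proof. by move=> bf; elim: t => //= t; exact: lbnd_op. Qed.

Lemma step_lin a f g s x :
  uss_step_exp (fun s => a * f s + g s) s x =
  a * uss_step_exp f s x + uss_step_exp g s x.
Proof.
case: s => l c; rewrite /uss_step_exp; case: pickP => // _.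
by rewrite mulr_sumr -big_split/=; apply: eq_bigr => i _; ring.
Qed.

Lemma op_lin a f g : lbnd f -> lbnd g ->
  uss_op p (fun s => a * f s + g s) = (fun s => a * uss_op p f s + uss_op p g s).
Proof.
move=> bf bg; apply/funext => s.
rewrite !uss_opE (funext (fun x => step_lin a f g s x)).
have bsf := bnd_step s bf; have bsg := bnd_step s bg.
by rewrite meanD ?meanZ//; exact: bndM.
Qed.

Definition Ex t f : R := iter t (uss_op p) f (uss_init m).

Lemma ExS t f : Ex t.+1 f = Ex t (uss_op p f).
Proof. by rewrite /Ex iterSr. Qed.

Lemma Ex_lin t a f g : lbnd f -> lbnd g ->
  Ex t (fun s => a * f s + g s) = a * Ex t f + Ex t g.
Proof.
elim: t f g => // t IH f g bf bg.
by rewrite !ExS op_lin// IH//; exact: lbnd_op.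
Qed.

Lemma op_cst a : uss_op p (fun=> a : R) = (fun=> a) :> (uss_state m -> R).
Proof.
apply/funext => -[l c]; rewrite uss_opE -[RHS]mean_cst.
congr mean; apply/funext => x; rewrite /uss_step_exp; case: pickP => // _.
under eq_bigr => i _.
  rewrite (_ : _ * _ = (#|uss_min_bins c|%:R)^-1 * a); last by ring.
  over.
by rewrite -mulr_suml sumr_const -[_ *+ _]mulr_natr mulVf ?mul1r// gt_eqF// card_min_bins_gt0.
Qed.

Lemma lbnd_cst a : lbnd (fun=> a). Proof. by move=> c; exact: bnd_cst. Qed.
Hint Resolve lbnd_cst lbndD lbndZ : core.

Lemma Ex_cst t a : Ex t (fun=> a) = a.
Proof. by elim: t => // t IH; rewrite ExS op_cst. Qed.

Lemma ExD t f g : lbnd f -> lbnd g -> Ex t (fun s => f s + g s) = Ex t f + Ex t g.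
Proof.
move=> bf bg; rewrite -[Ex t f]mul1r -Ex_lin//.
by congr Ex; apply/funext => s; rewrite mul1r.
Qed.

Lemma ExZ t a f : lbnd f -> Ex t (fun s => a * f s) = a * Ex t f.
Proof.
move=> bf; rewrite -[RHS]addr0 -(Ex_cst t 0) -Ex_lin//.
by congr Ex; apply/funext => s; rewrite addr0.
Qed.

(** An invariant containing all states of positive probability at time t. A bin with positive count
    is labelled because a first increment, at count 0, replaces the label with probability 1. *)
Definition reach t (s : uss_state m) : Prop :=
  [/\ inj_labels s.1, (forall i, (0 < s.2 i)%N -> s.1 i != None)
    & (\sum_i s.2 i)%N = t].

Lemma sum_incr c i : (\sum_j uss_incr c i j = (\sum_j c j).+1)%N.
Proof.
rewrite (bigD1 i)//= [in RHS](bigD1 i)//= /uss_incr eqxx addSn; congr (_ + _).+1.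
by apply: eq_bigr => j /negPf ->.
Qed.

Lemma reach_keep t l c i : reach t (l, c) -> l i != None ->
  reach t.+1 (l, uss_incr c i).
Proof.
move=> [/= il nl <-] li; split => //=; last exact: sum_incr.
by move=> j; rewrite /uss_incr; case: eqVneq => [->//|_]; exact: nl.
Qed.

Lemma reach_relabel t l c i x : reach t (l, c) -> fresh l x ->
  reach t.+1 (upd l i (Some x), uss_incr c i).
Proof.
move=> [/= il nl <-] /forallP fx; split => /=; last exact: sum_incr.
- move=> j k y; rewrite /upd.
  case: (eqVneq j i) => [->|_]; case: (eqVneq k i) => [->|_] //.
  + by move=> [<-] lk; have := fx k; rewrite lk eqxx.
  + by move=> lj [xy]; have := fx j; rewrite lj xy eqxx.
  + exact: il.
- move=> j; rewrite /upd /uss_incr; case: eqVneq => // _; exact: nl.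
Qed.

Lemma step_le t f g s x : (forall s, reach t.+1 s -> f s <= g s) -> reach t s ->
  uss_step_exp f s x <= uss_step_exp g s x.
Proof.
case: s => l c fg rs; rewrite /uss_step_exp; case: pickP => [i /eqP li|nl].
  by apply: fg; apply: reach_keep => //; rewrite li.
have fx : fresh l x by apply/forallP => i; rewrite nl.
apply: ler_sum => i _; rewrite ler_wpM2l// lerD//.
  by rewrite ler_wpM2l// fg//; exact: reach_relabel.
(* At count 0 the branch that keeps the label may leave the invariant, but it has weight 0. *)
have [c0|ci] := posnP (c i); first by rewrite c0 invr1 subrr !mul0r.
rewrite ler_wpM2l ?subr_ge0 ?inv_count_le1// fg//.
by apply: reach_keep => //; case: rs => _ /(_ _ ci).
Qed.

Lemma op_le t f g s : lbnd f -> lbnd g ->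
  (forall s, reach t.+1 s -> f s <= g s) -> reach t s -> uss_op p f s <= uss_op p g s.
Proof.
move=> bf bg fg rs; apply: le_mean; try exact: bnd_step.
by move=> x; exact: step_le fg rs.
Qed.

Lemma reach_init : reach 0 (uss_init m).
Proof. by split => //=; rewrite big1. Qed.

Lemma Ex_le t f g : lbnd f -> lbnd g ->
  (forall s, reach t s -> f s <= g s) -> Ex t f <= Ex t g.
Proof.
move=> bf bg; suff H u s : (forall s, reach (u + t) s -> f s <= g s) -> reach u s ->
    iter t (uss_op p) f s <= iter t (uss_op p) g s.
  by move=> fg; apply: (H 0%N) => //; exact: reach_init.
elim: t u s => [|t IH] u s fg rs /=; first by apply: fg; rewrite addn0.
apply: (@op_le u) => //; try exact: lbnd_iter.
by move=> s' rs'; apply: (IH u.+1) => //; rewrite addSnnS.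
Qed.

Lemma Ex_eq t f g : lbnd f -> lbnd g ->
  (forall s, reach t s -> f s = g s) -> Ex t f = Ex t g.
Proof.
by move=> bf bg fg; apply/eqP; rewrite eq_le !Ex_le// => s /fg ->.
Qed.

Lemma ExS_le t f g : lbnd f -> lbnd g ->
  (forall s, reach t s -> uss_op p f s <= g s) -> Ex t.+1 f <= Ex t g.
Proof. by move=> bf bg fg; rewrite ExS; apply: Ex_le => //; exact: lbnd_op. Qed.

Lemma Ex_norm_le t f g : lbnd f -> lbnd g ->
  (forall s, reach t s -> `|f s| <= g s) -> `|Ex t f| <= Ex t g.
Proof.
move=> bf bg fg; rewrite ler_norml -mulN1r -ExZ//; apply/andP; split.
  by apply: Ex_le => // [|s /fg]; [exact: lbndZ|rewrite ler_norml mulN1r => /andP[]].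
by apply: Ex_le => // s /fg; rewrite ler_norml => /andP[].
Qed.

(** * Moments of the count deviations *)

Definition dev t c i : R := (c i)%:R - t%:R / m%:R.

Lemma dev_incr t c i j :
  dev t.+1 (uss_incr c j) i = dev t c i + ((i == j)%:R - (m%:R)^-1).
Proof.
rewrite /dev /uss_incr; case: eqP => _; rewrite -?[in LHS]natr1 mulrDl div1r /=.
  by rewrite -natr1; ring.
by ring.
Qed.

Lemma lbnd_count (F : ('I_m -> nat) -> R) : lbnd (fun s => F s.2).
Proof. by move=> c; exists `|F c|. Qed.

Lemma jump_cst i a l : jump i (fun=> a) l = 0.
Proof.
by rewrite -[RHS](mean_cst 0); congr mean; apply/funext => x; rewrite subrr mulr0.
Qed.

Lemma op_count (F : ('I_m -> nat) -> R) l c : inj_labels l ->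
  uss_op p (fun s => F s.2) (l, c) = \sum_i rate l c i * F (uss_incr c i).
Proof.
move=> il; rewrite uss_op_inj//; last exact: lbnd_count.
by rewrite [X in _ + X]big1 ?addr0// => i _; rewrite (jump_cst i (F _)) !mulr0.
Qed.

(* The drift of a bin with label j is p_j - 1/m <= 0, except for the minimal
   bins, which share the fresh items and balance the sum of all drifts to 0. *)
Lemma convex_drift_le0 t l c (dphi : R -> R) : inj_labels l ->
  {homo dphi : x y / x <= y} ->
  \sum_i dphi (dev t c i) * (rate l c i - (m%:R)^-1) <= 0.
Proof.
move=> il mono; have [i0 i0M] := min_bin_ex c.
set d0 := dphi (dev t c i0).
have ci0 j : (c i0 <= c j)%N by move/min_binP: i0M; exact.
have d0le i : d0 <= dphi (dev t c i) by apply: mono; rewrite lerB// ler_nat.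
have m0 := mR_gt0.
have pm i : popt (l i) - (m%:R)^-1 <= 0.
  by rewrite subr_le0 (le_trans (popt_le _))// ltW.
apply: (@le_trans _ _ (\sum_i (d0 * (popt (l i) - (m%:R)^-1) +
    qfresh l * d0 * omin c i))).
  apply: ler_sum => i _; rewrite /rate.
  have -> : qfresh l * d0 * omin c i = qfresh l * (dphi (dev t c i) * omin c i).
    rewrite /omin; case: (boolP (i \in _)) => [/min_binP ci|_]; last by rewrite mul0r !mulr0.
    have -> : d0 = dphi (dev t c i).
      by congr dphi; rewrite /dev (_ : c i0 = c i)//; apply/eqP; rewrite eqn_leq ci0 ci.
    by rewrite mulrA.
  by have := ler_wnM2r (pm i) (d0le i); lra.
rewrite big_split/= -!mulr_sumr sum_omin mulr1 sumrB sumr_const card_ord.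
rewrite -[_ *+ m]mulr_natr mulVf ?gt_eqF// qfresh_inj//.
by rewrite le_eqVlt; apply/orP; left; apply/eqP; ring.
Qed.

(** Lyapunov estimate: the first-order terms have nonpositive total drift, so a convex functional of
    the deviations grows only by its second-order remainder [psi]. *)
Lemma op_dev_le (phi dphi psi : R -> R) t l c :
  (forall x y, `|y| <= 1 -> phi (x + y) <= phi x + dphi x * y + psi x) ->
  {homo dphi : x y / x <= y} -> inj_labels l ->
  uss_op p (fun s => \sum_i phi (dev t.+1 s.2 i)) (l, c) <=
  \sum_i phi (dev t c i) + \sum_i psi (dev t c i).
Proof.
move=> taylor mono il; rewrite (@op_count (fun c => \sum_i phi (dev t.+1 c i)))//.
have m0 := mR_gt0.
have m1 : (m%:R)^-1 <= 1 :> R by rewrite invf_le1// ler1n.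
have mV : 0 < (m%:R)^-1 :> R by rewrite invr_gt0.
apply: (@le_trans _ _ (\sum_j rate l c j * \sum_i (phi (dev t c i) +
    dphi (dev t c i) * ((i == j)%:R - (m%:R)^-1) + psi (dev t c i)))).
  apply: ler_sum => j _; rewrite ler_wpM2l ?rate_ge0//.
  apply: ler_sum => i _; rewrite dev_incr taylor// ler_norml.
  by case: eqP => _ /=; apply/andP; split; lra.
rewrite (_ : \sum_j _ = \sum_i (phi (dev t c i) + psi (dev t c i)) +
    \sum_i dphi (dev t c i) * (rate l c i - (m%:R)^-1)).
  by rewrite big_split/= -[leRHS]addr0 lerD2l convex_drift_le0.
under eq_bigr do rewrite mulr_sumr.
rewrite exchange_big/= -big_split/=; apply: eq_bigr => i _.
have -> : rate l c i = \sum_j rate l c j * (i == j)%:R.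
  rewrite (bigD1 i)//= eqxx mulr1 big1 ?addr0// => j ji.
  by rewrite eq_sym (negPf ji) mulr0.
rewrite (eq_bigr (fun j => rate l c j * (phi (dev t c i) + psi (dev t c i) -
    dphi (dev t c i) / m%:R) + dphi (dev t c i) * (rate l c j * (i == j)%:R))).
  by rewrite big_split/= -mulr_suml -mulr_sumr sum_rate//; ring.
by move=> j _; ring.
Qed.

Lemma lbnd_dev (phi : R -> R) t : lbnd (fun s => \sum_i phi (dev t s.2 i)).
Proof. exact: (@lbnd_count (fun c => \sum_i phi (dev t c i))). Qed.
Hint Resolve lbnd_dev : core.

Lemma dev_init i : dev 0 (uss_init m).2 i = 0.
Proof. by rewrite /dev mul0r subr0. Qed.

Lemma second_moment t : Ex t (fun s => \sum_i dev t s.2 i ^+ 2) <= m%:R * t%:R.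
Proof.
elim: t => [|t IH].
  by rewrite mulr0 /Ex/= big1// => i _; rewrite dev_init expr0n.
apply: (@le_trans _ _ (Ex t (fun s => \sum_i dev t s.2 i ^+ 2 + m%:R))).
  apply: ExS_le; [exact: (lbnd_dev (fun x => x ^+ 2))| |].
    by apply: lbndD => //; exact: (lbnd_dev (fun x => x ^+ 2)).
  move=> [l c] [/= il _ _].
  have := @op_dev_le (fun x => x ^+ 2) (fun x => 2 * x) (fun=> 1) t l c.
  rewrite sumr_const card_ord; apply => //.
    by move=> x y; rewrite ler_norml => /andP[? ?]; nra.
  by move=> x y xy; lra.
rewrite ExD ?Ex_cst//; last exact: (lbnd_dev (fun x => x ^+ 2)).
by rewrite -natr1 mulrDr mulr1 lerD2r.
Qed.

(** The second moment would give only O(1/r) for the probability that a deviation is of order r,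
    which is not summable; the fourth gives O(1/r^2). One step adds at most 8 m t + 3 m, less than
    the increment of 8 m t^2. *)
Lemma fourth_moment t :
  Ex t (fun s => \sum_i dev t s.2 i ^+ 4) <= 8 * m%:R * t%:R ^+ 2.
Proof.
elim: t => [|t IH].
  by rewrite expr0n mulr0 /Ex/= big1// => i _; rewrite dev_init expr0n.
have l4 := lbnd_dev (fun x => x ^+ 4) t; have l2 := lbnd_dev (fun x => x ^+ 2) t.
apply: (@le_trans _ _ (Ex t (fun s => \sum_i dev t s.2 i ^+ 4 +
    (8 * (\sum_i dev t s.2 i ^+ 2) + 3 * m%:R)))).
  apply: ExS_le; [exact: (lbnd_dev (fun x => x ^+ 4))|by auto 7|].
  move=> [l c] [/= il _ _].
  have := @op_dev_le (fun x => x ^+ 4) (fun x => 4 * x ^+ 3)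
    (fun x => 8 * x ^+ 2 + 3) t l c.
  rewrite big_split/= sumr_const card_ord -mulr_sumr -[3 *+ m]mulr_natr; apply => //.
    move=> x y; rewrite ler_norml => /andP[y0 y1].
    have y2 : y ^+ 2 <= 1 by nra.
    have y20 : 0 <= y ^+ 2 by nra.
    have y4 : y ^+ 4 <= 1 by rewrite (_ : y ^+ 4 = y ^+ 2 * y ^+ 2); [nra|ring].
    have x20 : 0 <= x ^+ 2 by nra.
    have xy2 : x ^+ 2 * y ^+ 2 <= x ^+ 2 by nra.
    have xy3 : 4 * x * y ^+ 3 <= 2 * x ^+ 2 + 2.
      have -> : 4 * x * y ^+ 3 = 4 * (x * y) * y ^+ 2 by ring.
      have /andP[h1 h2] : - (x ^+ 2 + 1) <= 2 * (x * y) <= x ^+ 2 + 1.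
        have := sqr_ge0 (x - y); have := sqr_ge0 (x + y).
        by rewrite !sqrrD sqrrN => ? ?; apply/andP; split; lra.
      by nra.
    have -> : (x + y) ^+ 4 = x ^+ 4 + 4 * x ^+ 3 * y + 6 * (x ^+ 2 * y ^+ 2)
        + 4 * x * y ^+ 3 + y ^+ 4 by ring.
    by lra.
  move=> x y xy; rewrite ler_wpM2l// -subr_ge0.
  have -> : y ^+ 3 - x ^+ 3 = (y - x) * ((x + y) ^+ 2 + x ^+ 2 + y ^+ 2) / 2 by field.
  by rewrite divr_ge0// mulr_ge0 ?subr_ge0// !addr_ge0 ?sqr_ge0.
rewrite !ExD ?ExZ ?Ex_cst//; try by auto 7.
have -> : t.+1%:R = t%:R + 1 :> R by rewrite natr1.
have := mulr_ge0 (ltW mR_gt0) (ler0n R t).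
by have := second_moment t; have := mR_gt0; lra.
Qed.

Lemma first_moment t : (0 < t)%N ->
  Ex t (fun s => \sum_i `|dev t s.2 i|) <= m%:R * Num.sqrt t%:R.
Proof.
move=> t0; set a := Num.sqrt _; have a0 : 0 < a by rewrite sqrtr_gt0 ltr0n.
have a2 : a ^+ 2 = t%:R by rewrite sqr_sqrtr.
have l2 := lbnd_dev (fun x => x ^+ 2) t.
(* Pointwise |d| <= d^2/(2a) + a/2 in place of the Cauchy-Schwarz inequality; a = sqrt t balances
   the two terms. *)
apply: (@le_trans _ _ (Ex t (fun s => (2 * a)^-1 * \sum_i dev t s.2 i ^+ 2 +
    m%:R * (a / 2)))).
  apply: Ex_le => //; first by auto.
  move=> s _; have -> : m%:R * (a / 2) = \sum_(i < m) (a / 2).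
    by rewrite sumr_const card_ord -[RHS]mulr_natl.
  rewrite mulr_sumr -big_split/=; apply: ler_sum => i _.
  rewrite -real_normK ?num_real//; set d := `|_|.
  rewrite -subr_ge0 (_ : _ - _ = (2 * a)^-1 * (d - a) ^+ 2); last by field; rewrite gt_eqF.
  by rewrite mulr_ge0 ?sqr_ge0// invr_ge0 mulr_ge0// ltW.
rewrite Ex_lin// Ex_cst.
have : (2 * a)^-1 * Ex t (fun s => \sum_i dev t s.2 i ^+ 2) <= m%:R * (a / 2).
  rewrite mulrC ler_pdivrMr ?mulr_gt0// (le_trans (second_moment t))//.
  by rewrite -a2 le_eqVlt; apply/orP; left; apply/eqP; field.
by lra.
Qed.

(** * Comparison of the sketch with the averaged chain *)

(** The drift of the subtracted sum contributes -(m/t) sum_j qfresh omin_j gain_j + gen h / t.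
    Actual relabellings contribute about (m/t) sum_j qfresh omin_j gain_j, which cancels the first
    term and leaves [gen h / t]. *)
Definition corrected t h (s : uss_state m) : R :=
  h s.1 - m%:R / t%:R * \sum_i dev t s.2 i * gain i h s.1.

Lemma bnd_gain i h : bnd h -> bnd (gain i h).
Proof. by move=> [C hC]; exists (2 * C) => l; exact: gain_norm_le. Qed.

Lemma lbnd_labels h : bnd h -> lbnd (fun s => h s.1).
Proof. by move=> [C hC] c; exists C. Qed.

Lemma bnd_corrector t c h : bnd h ->
  bnd (fun l => m%:R / t%:R * \sum_i dev t c i * gain i h l).
Proof.
move=> bh; apply: bndM => //; apply: bnd_sum => i.
by apply: bndM => //; exact: bnd_gain.
Qed.

Lemma lbnd_corrected t h : bnd h -> lbnd (corrected t h).
Proof. by move=> bh c; apply: bndD => //; apply: bndN; exact: bnd_corrector. Qed.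

Lemma jump_norm_le i h l C : (forall l, `|h l| <= C) -> `|jump i h l| <= 2 * C.
Proof.
move=> hC; rewrite jumpE normrM ger0_norm ?(ltW (qfresh_gt0 l))//.
rewrite -[leRHS]mul1r ler_pM ?(ltW (qfresh_gt0 l)) ?qfresh_le1//.
exact: gain_norm_le.
Qed.

Lemma jump_corrected i t c h l : bnd h ->
  jump i (fun l => corrected t h (l, c)) l =
  jump i h l - m%:R / t%:R * \sum_j dev t c j * jump i (gain j h) l.
Proof.
move=> bh; have bg j := bnd_gain j bh; rewrite /corrected /=.
have bj j := bnd_jump i l (bg j).
have -> : \sum_j dev t c j * jump i (gain j h) l = mean (fun x => \sum_j dev t c j *
    ((fresh l x)%:R * (gain j h (upd l i (Some x)) - gain j h l))).
  rewrite mean_sum; last by move=> j; have := bj j => bjj; bounded.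
  by apply: eq_bigr => j _; rewrite meanZ.
have b1 : bnd (fun x => \sum_j dev t c j *
    ((fresh l x)%:R * (gain j h (upd l i (Some x)) - gain j h l))).
  by apply: bnd_sum => j; have := bj j => bjj; bounded.
rewrite -meanZ// /jump -meanB; [|exact: bnd_jump|exact: bndM].
congr mean; apply/funext => x.
have -> : \sum_j dev t c j *
    ((fresh l x)%:R * (gain j h (upd l i (Some x)) - gain j h l)) =
  (fresh l x)%:R * (\sum_j dev t c j * gain j h (upd l i (Some x)) -
                    \sum_j dev t c j * gain j h l).
  by rewrite -sumrB mulr_sumr; apply: eq_bigr => j _; ring.
by ring.
Qed.

Lemma inv_count_min c i i0 : i0 \in uss_min_bins c ->
  omin c i * inv_count c i = omin c i * inv_count c i0.
Proof.
move=> /min_binP c0; rewrite /omin.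
case: (boolP (i \in _)) => [/min_binP ci|_]; last by rewrite !mul0r.
by rewrite /inv_count (_ : c i = c i0)//; apply/eqP; rewrite eqn_leq c0 ci.
Qed.

(** An exact expansion: motion of the counts at fixed labels, effect of a relabelling on [h], effect
    of a relabelling on the corrector. *)
Lemma op_corrected r l c h i0 : bnd h -> inj_labels l -> i0 \in uss_min_bins c ->
  uss_op p (corrected r.+1 h) (l, c) =
  h l - m%:R / r.+1%:R *
      (\sum_j (dev r c j + (rate l c j - (m%:R)^-1)) * gain j h l)
  + inv_count c i0 * \sum_j (qfresh l * omin c j) * gain j h l
  - m%:R / r.+1%:R * (inv_count c i0 *
      \sum_i omin c i * \sum_j dev r.+1 (uss_incr c i) j * jump i (gain j h) l).
Proof.
move=> bh il i0M; rewrite uss_op_inj//; last exact: lbnd_corrected.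
have -> : \sum_i rate l c i * corrected r.+1 h (l, uss_incr c i) =
  h l - m%:R / r.+1%:R *
      (\sum_j (dev r c j + (rate l c j - (m%:R)^-1)) * gain j h l).
  rewrite (eq_bigr (fun i => rate l c i * h l - m%:R / r.+1%:R *
      \sum_j rate l c i * (dev r.+1 (uss_incr c i) j * gain j h l))); last first.
    by move=> i _; rewrite /corrected/= -mulr_sumr; ring.
  rewrite sumrB -mulr_suml sum_rate// mul1r -mulr_sumr; congr (_ - _ * _).
  rewrite exchange_big/=; apply: eq_bigr => j _.
  have -> : rate l c j = \sum_i rate l c i * (j == i)%:R.
    rewrite (bigD1 j)//= eqxx mulr1 big1 ?addr0// => i ij.
    by rewrite eq_sym (negPf ij) mulr0.
  rewrite (eq_bigr (fun i => rate l c i * ((dev r c j - (m%:R)^-1) * gain j h l) +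
    rate l c i * (j == i)%:R * gain j h l)).
    by rewrite big_split/= -!mulr_suml sum_rate//; ring.
  by move=> i _; rewrite dev_incr; ring.
rewrite -!addrA; congr (_ + (_ + _)).
rewrite (eq_bigr (fun i => inv_count c i0 * (qfresh l * omin c i * gain i h l) -
    m%:R / r.+1%:R * (inv_count c i0 * (omin c i *
      \sum_j dev r.+1 (uss_incr c i) j * jump i (gain j h) l)))).
  by rewrite sumrB -!mulr_sumr.
move=> i _; rewrite mulrA (inv_count_min i i0M) jump_corrected//.
by rewrite [jump i h l]jumpE; ring.
Qed.

Lemma min_bin_dev r c i0 : (0 < r)%N ->
  inv_count c i0 - m%:R / r%:R =
  - (m%:R / r%:R * inv_count c i0 * (dev r c i0 + 1)).
Proof.
move=> r0; have m0 := mR_gt0; have r0' : 0 < r%:R :> R by rewrite ltr0n.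
have n0 : 0 < (c i0)%:R + 1 :> R by rewrite natr1 ltr0n.
rewrite /inv_count /dev -natr1; field.
by rewrite !gt_eqF.
Qed.

Lemma corrected_step r l c h i0 : (0 < r)%N -> (forall l, `|h l| <= 1) ->
  inj_labels l -> i0 \in uss_min_bins c ->
  `|uss_op p (corrected r.+1 h) (l, c) - corrected r (stepK r h) (l, c)| <=
  8 * m%:R ^+ 2 / r%:R * (\sum_i `|dev r c i| + m%:R) * (inv_count c i0 + r%:R^-1).
Proof.
move=> r0 h1 il i0M; have bh : bnd h by exists 1.
have bg := bnd_gen bh; rewrite (op_corrected r bh il i0M).
set S := \sum_i `|dev r c i|; set v := inv_count c i0.
set X := \sum_i omin c i * _.
pose Y := \sum_j (dev r c j + (rate l c j - (m%:R)^-1)) * gain j h l.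
pose Z := \sum_j (qfresh l * omin c j) * gain j h l.
pose W := \sum_j dev r c j * gain j (gen h) l.
have m0 := mR_gt0; have m1 : 1 <= m%:R :> R by rewrite ler1n.
have r0' : 0 < r%:R :> R by rewrite ltr0n.
have r1' : 0 < r%:R + 1 :> R by lra.
have rV0 : 0 < r%:R^-1 :> R by rewrite invr_gt0.
have v0 : 0 < v by exact: inv_count_gt0.
have S0 : 0 <= S by exact: sumr_ge0.
have G2 j l' : `|gain j h l'| <= 2 by rewrite -[leRHS]mulr1 gain_norm_le.
have -> : corrected r (stepK r h) (l, c) = h l - m%:R / r%:R * Y + m%:R / r%:R * Z
    - m%:R / r%:R ^+ 2 * W.
  have -> : corrected r (stepK r h) (l, c) = h l + r%:R^-1 * gen h l
     - m%:R / r%:R * (\sum_j dev r c j * gain j h l) - m%:R / r%:R ^+ 2 * W.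
    rewrite /corrected/= {1}/stepK -[RHS]addrA -opprD; congr (_ - _).
    have -> : m%:R / r%:R ^+ 2 * W = m%:R / r%:R * (r%:R^-1 * W).
      by rewrite /W; field; rewrite gt_eqF.
    rewrite -mulrDr; congr (_ * _); rewrite /W mulr_sumr -big_split/=.
    apply: eq_bigr => j _; rewrite /stepK gainD ?gainZ//; last exact: bndM.
    by ring.
  congr (_ - _); rewrite -!addrA; congr (_ + _).
  rewrite /gen /Y /Z !mulr_sumr -!sumrN -!big_split/=; apply: eq_bigr => j _.
  by rewrite /rate; field; rewrite !gt_eqF.
rewrite -/Y -/Z -natr1.
(* Four errors remain: 1/(N+1) replaced by m/r, the factor m/(r+1) replaced by m/r, relabellings
   acting on the corrector, and the corrector of [gen h / r]. *)
have -> : h l - m%:R / (r%:R + 1) * Y + v * Z - m%:R / (r%:R + 1) * (v * X) -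
    (h l - m%:R / r%:R * Y + m%:R / r%:R * Z - m%:R / r%:R ^+ 2 * W) =
  - (m%:R / r%:R * v * (dev r c i0 + 1)) * Z + m%:R / (r%:R * (r%:R + 1)) * Y
  - m%:R / (r%:R + 1) * v * X + m%:R / r%:R ^+ 2 * W.
  by rewrite -min_bin_dev// -/v; field; rewrite !gt_eqF.
have hZ : `|Z| <= 2.
  rewrite (le_trans (ler_norm_sum _ _ _))//.
  apply: (@le_trans _ _ (\sum_j qfresh l * omin c j * 2)).
    apply: ler_sum => j _; rewrite normrM ger0_norm.
      by rewrite ler_wpM2l ?G2// mulr_ge0 ?omin_ge0// ltW// qfresh_gt0.
    by rewrite mulr_ge0 ?omin_ge0// ltW// qfresh_gt0.
  by rewrite -mulr_suml -mulr_sumr sum_omin mulr1 ler_piMl// qfresh_le1.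
have hY : `|Y| <= 2 * (S + 2).
  rewrite (le_trans (ler_norm_sum _ _ _))//.
  apply: (@le_trans _ _ (\sum_j (`|dev r c j| + (rate l c j + (m%:R)^-1)) * 2)).
    apply: ler_sum => j _; rewrite normrM ler_pM//.
    rewrite (le_trans (ler_normD _ _))// lerD2l (le_trans (ler_normB _ _))//.
    by rewrite !ger0_norm ?rate_ge0// invr_ge0.
  rewrite -mulr_suml 2!big_split/= sum_rate// sumr_const card_ord.
  by rewrite -[_ *+ m]mulr_natr mulVf ?gt_eqF// -/S; lra.
have hX : `|X| <= 4 * (S + m%:R).
  rewrite (le_trans (ler_norm_sum _ _ _))//.
  apply: (@le_trans _ _ (\sum_i omin c i * (4 * (S + m%:R)))); last first.
    by rewrite -mulr_suml sum_omin mul1r.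
  apply: ler_sum => i _; rewrite normrM ger0_norm ?omin_ge0// ler_wpM2l ?omin_ge0//.
  rewrite (le_trans (ler_norm_sum _ _ _))//.
  apply: (@le_trans _ _ (\sum_j (`|dev r c j| + 1) * 4)).
    apply: ler_sum => j _; rewrite normrM ler_pM//; last first.
      by rewrite (_ : 4 = 2 * 2) ?jump_norm_le// -natrM.
    rewrite dev_incr (le_trans (ler_normD _ _))// lerD2l.
    have mV : 0 < (m%:R)^-1 :> R by rewrite invr_gt0.
    have mV1 : (m%:R)^-1 <= 1 :> R by rewrite invf_le1.
    by rewrite ler_norml; case: eqP => _ /=; apply/andP; split; lra.
  by rewrite -mulr_suml big_split/= sumr_const card_ord -/S mulrC.
have hW : `|W| <= 4 * m%:R * S.
  rewrite (le_trans (ler_norm_sum _ _ _))// /S mulr_sumr ler_sum// => j _.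
  rewrite normrM mulrC ler_wpM2r// (_ : 4 * m%:R = 2 * (m%:R * (2 * 1))); last by ring.
  by apply: gain_norm_le => l'; exact: gen_norm_le.
have hd : `|dev r c i0 + 1| <= S + 1.
  rewrite (le_trans (ler_normD _ _))// normr1 lerD2r /S (bigD1 i0)//= lerDl.
  exact: sumr_ge0.
have mr0 : 0 < m%:R / r%:R :> R by rewrite divr_gt0.
have ns a a' x b : 0 <= a -> a <= a' -> `|x| <= b -> `|a * x| <= a' * b.
  by move=> a0 aa xb; rewrite normrM (ger0_norm a0) ler_pM.
have r1V : (r%:R + 1)^-1 <= r%:R^-1 :> R by rewrite lef_pV2// ?posrE//; lra.
have r1V0 : 0 < (r%:R + 1)^-1 :> R by rewrite invr_gt0.
have mrv0 := mulr_gt0 mr0 v0.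
have mr1 : m%:R / (r%:R + 1) <= m%:R / r%:R :> R by rewrite ler_wpM2l// ltW.
have mr10 : 0 <= m%:R / (r%:R + 1) :> R by rewrite divr_ge0// ltW.
have t1 : `|- (m%:R / r%:R * v * (dev r c i0 + 1)) * Z| <=
    m%:R / r%:R * v * (S + 1) * 2.
  rewrite mulNr normrN -[X in `|X|]mulrA -[leRHS]mulrA; apply: ns => //; first exact: ltW.
  by rewrite normrM ler_pM.
have t2 : `|m%:R / (r%:R * (r%:R + 1)) * Y| <= m%:R / r%:R * r%:R^-1 * (2 * (S + 2)).
  rewrite invfM mulrA; apply: ns; [by apply: mulr_ge0; exact: ltW| |by []].
  by apply: ler_wpM2l => //; exact: ltW.
have t3 : `|m%:R / (r%:R + 1) * v * X| <= m%:R / r%:R * v * (4 * (S + m%:R)).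
  apply: ns; [by apply: mulr_ge0 => //; exact: ltW| |by []].
  by apply: ler_wpM2r => //; exact: ltW.
have t4 : `|m%:R / r%:R ^+ 2 * W| <= m%:R / r%:R * r%:R^-1 * (4 * m%:R * S).
  by rewrite expr2 invfM mulrA; apply: ns => //; apply: mulr_ge0; exact: ltW.
set A := m%:R / r%:R in t1 t2 t3 t4 mr0 *.
have -> : 8 * m%:R ^+ 2 / r%:R * (S + m%:R) * (v + r%:R^-1) =
  A * v * (8 * m%:R * (S + m%:R)) + A * r%:R^-1 * (8 * m%:R * (S + m%:R)).
  by rewrite /A; ring.
rewrite (le_trans (ler_normD _ _))//.
have := ler_normB (- (A * v * (dev r c i0 + 1)) * Z +
  m%:R / (r%:R * (r%:R + 1)) * Y) (m%:R / (r%:R + 1) * v * X).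
have := ler_normD (- (A * v * (dev r c i0 + 1)) * Z)
  (m%:R / (r%:R * (r%:R + 1)) * Y).
have Av0 : 0 <= A * v by rewrite mulr_ge0// ltW.
have Ar0 : 0 <= A * r%:R^-1 by rewrite mulr_ge0// ltW.
have e1 : (S + 1) * 2 + 4 * (S + m%:R) <= 8 * m%:R * (S + m%:R) by nra.
have e2 : 2 * (S + 2) + 4 * m%:R * S <= 8 * m%:R * (S + m%:R) by nra.
have := ler_wpM2l Av0 e1; have := ler_wpM2l Ar0 e2.
by rewrite !mulrDr !mulrA in t1 t2 t3 t4 *; lra.
Qed.

(** The counts and their means t/m both add up to r. This crude bound serves when the minimal count
    is atypically small. *)
Lemma sum_abs_dev_le r l c : reach r (l, c) -> \sum_i `|dev r c i| <= 2 * r%:R.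
Proof.
move=> [_ _ /= sc]; have m0 := mR_gt0.
apply: (@le_trans _ _ (\sum_i ((c i)%:R + r%:R / m%:R))).
  apply: ler_sum => i _; rewrite (le_trans (ler_normB _ _))//.
  by rewrite !ger0_norm// divr_ge0// ltW.
rewrite big_split/= -natr_sum sc sumr_const card_ord -[_ *+ m]mulr_natr.
by rewrite divfK ?gt_eqF//; lra.
Qed.

(* When the minimal count is below r/(2m), the deviation of the minimal bin is at
   least r/(2m), so that the trivial bound is absorbed by the fourth moment. *)
Lemma corrected_step_moment r s h : (m <= r)%N -> (forall l, `|h l| <= 1) ->
  reach r s ->
  `|uss_op p (corrected r.+1 h) s - corrected r (stepK r h) s| <=
  8 * m%:R ^+ 2 * ((1 + 2 * m%:R) / r%:R ^+ 2 * (\sum_i `|dev r s.2 i| + m%:R)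
    + 96 * m%:R ^+ 4 / r%:R ^+ 4 * \sum_i dev r s.2 i ^+ 4).
Proof.
case: s => l c mr h1 rs; have [il _ _] := rs.
have r0 : (0 < r)%N by exact: leq_trans mr.
have [i0 i0M] := min_bin_ex c.
rewrite (le_trans (corrected_step r0 h1 il i0M))//=.
have m0 := mR_gt0; have r0' : 0 < r%:R :> R by rewrite ltr0n.
have m1 : 1 <= m%:R :> R by rewrite ler1n.
have r1 : 1 <= r%:R :> R by rewrite ler1n.
have mrR : m%:R <= r%:R :> R by rewrite ler_nat.
have S2 := sum_abs_dev_le rs.
set S := \sum_i `|_| in S2 *; set V := \sum_i _ ^+ 4; set v := inv_count c i0.
have S0 : 0 <= S by exact: sumr_ge0.
have V0 : 0 <= V by apply: sumr_ge0 => i _; rewrite exprn_even_ge0.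
have v0 : 0 < v by exact: inv_count_gt0.
have v1 : v <= 1 by exact: inv_count_le1.
have -> : 8 * m%:R ^+ 2 / r%:R * (S + m%:R) * (v + r%:R^-1) =
  8 * m%:R ^+ 2 * (r%:R^-1 * ((S + m%:R) * (v + r%:R^-1))) by ring.
rewrite ler_pM2l ?mulr_gt0 ?exprn_gt0//.
have rV0 : 0 < r%:R^-1 :> R by rewrite invr_gt0.
have rV1 : r%:R^-1 <= 1 :> R by rewrite invf_le1.
have P0 : 0 <= 96 * m%:R ^+ 4 / r%:R ^+ 4 * V.
  by apply: mulr_ge0 => //; rewrite divr_ge0 ?mulr_ge0 ?exprn_ge0.
have Q0 : 0 <= (1 + 2 * m%:R) / r%:R ^+ 2 * (S + m%:R).
  by rewrite mulr_ge0 ?addr_ge0// divr_ge0 ?addr_ge0 ?mulr_ge0 ?exprn_ge0.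
have [vr|vr] := leP v (2 * m%:R / r%:R).
  apply: (@le_trans _ _ ((1 + 2 * m%:R) / r%:R ^+ 2 * (S + m%:R))); last first.
    by lra.
  have -> : (1 + 2 * m%:R) / r%:R ^+ 2 * (S + m%:R) =
    r%:R^-1 * ((S + m%:R) * (2 * m%:R / r%:R + r%:R^-1)).
    by field; rewrite gt_eqF.
  rewrite ler_pM2l//; apply: ler_wpM2l; last by rewrite lerD2r.
  by apply: addr_ge0 => //; exact: ltW.
apply: (@le_trans _ _ (96 * m%:R ^+ 4 / r%:R ^+ 4 * V)); last first.
  by lra.
have dmin : dev r c i0 <= - (r%:R / (2 * m%:R)).
  have n0 : 0 < (c i0).+1%:R :> R by rewrite ltr0n.
  have : (c i0).+1%:R * (2 * m%:R) < r%:R :> R.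
    move: vr; rewrite /v /inv_count -[ltRHS]div1r ltr_pdivlMr// mulrAC.
    by rewrite ltr_pdivrMr// mul1r [ltLHS]mulrC.
  rewrite /dev -natr1 => cr.
  have -> : (r%:R / m%:R : R) = 2 * (r%:R / (2 * m%:R)) by field; rewrite gt_eqF.
  have : (c i0)%:R <= r%:R / (2 * m%:R) :> R.
    by rewrite ler_pdivlMr ?mulr_gt0//; nra.
  by lra.
have d4 : (r%:R / (2 * m%:R)) ^+ 4 <= V.
  apply: (@le_trans _ _ (dev r c i0 ^+ 4)).
    have a0 : 0 <= r%:R / (2 * m%:R) :> R by apply: divr_ge0 => //; exact: mulr_ge0.
    have -> : dev r c i0 ^+ 4 = (- dev r c i0) ^+ 4 by ring.
    by apply: lerXn2r; rewrite ?nnegrE; lra.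
  by rewrite /V (bigD1 i0)//= lerDl sumr_ge0// => i _; rewrite exprn_even_ge0.
(* The left side of the goal is at most 3 * 2, by S <= 2r, m <= r, v <= 1 and r >= 1; hence 96 = 6 *
   16. *)
have : 1 <= 16 * m%:R ^+ 4 / r%:R ^+ 4 * V.
  have mr4 : 0 < 16 * m%:R ^+ 4 / r%:R ^+ 4 :> R.
    by rewrite divr_gt0 ?mulr_gt0 ?exprn_gt0.
  rewrite (le_trans _ (ler_wpM2l (ltW mr4) d4))//.
  by rewrite le_eqVlt; apply/orP; left; apply/eqP; field; rewrite !gt_eqF.
have -> : 96 * m%:R ^+ 4 / r%:R ^+ 4 * V = 6 * (16 * m%:R ^+ 4 / r%:R ^+ 4 * V) by ring.
suff : r%:R^-1 * ((S + m%:R) * (v + r%:R^-1)) <= 6 by lra.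
rewrite mulrA; apply: (@le_trans _ _ (3 * 2)); last by lra.
apply: ler_pM.
- by apply: mulr_ge0; [exact: ltW|rewrite addr_ge0].
- by apply: addr_ge0; exact: ltW.
- by rewrite mulrC ler_pdivrMr//; lra.
- by lra.
Qed.

(** Obtained from [corrected_step_moment] by inserting 2 m sqrt r for the first moment plus m, and 8
    m r^2 for the fourth moment. *)
Definition step_const : R :=
  8 * m%:R ^+ 2 * ((1 + 2 * m%:R) * (2 * m%:R) + 96 * (8 * m%:R ^+ 5)).

Lemma step_const_ge0 : 0 <= step_const.
Proof.
have m0 := ltW mR_gt0.
by rewrite mulr_ge0// ?addr_ge0// ?mulr_ge0// ?addr_ge0// ?mulr_ge0// ?exprn_ge0.
Qed.

Lemma Ex_corrected_step r h : (m <= r)%N -> (forall l, `|h l| <= 1) ->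
  `|Ex r.+1 (corrected r.+1 h) - Ex r (corrected r (stepK r h))| <=
  step_const / (r%:R * Num.sqrt r%:R).
Proof.
move=> mr h1; have bh : bnd h by exists 1.
have r0 : (0 < r)%N by exact: leq_trans mr.
have m0 := mR_gt0; have r0' : 0 < r%:R :> R by rewrite ltr0n.
have l1 := lbnd_dev (fun x => `|x|) r; have l4 := lbnd_dev (fun x => x ^+ 4) r.
have bc := lbnd_corrected r (bnd_stepK r bh).
have bo := lbnd_op (lbnd_corrected r.+1 bh).
rewrite ExS -mulN1r -ExZ// -ExD//; last exact: lbndZ.
apply: (@le_trans _ _ (Ex r (fun s => 8 * m%:R ^+ 2 *
   ((1 + 2 * m%:R) / r%:R ^+ 2 * (\sum_i `|dev r s.2 i| + m%:R)
    + 96 * m%:R ^+ 4 / r%:R ^+ 4 * \sum_i dev r s.2 i ^+ 4)))).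
  apply: Ex_norm_le; [by auto|by auto 8|move=> s rs].
  by rewrite mulN1r; exact: corrected_step_moment.
rewrite ExZ; last by auto 8.
rewrite ExD; [|by auto 8|by auto 8].
rewrite ExZ; last by auto.
rewrite ExD// Ex_cst ExZ//.
set q := Num.sqrt r%:R; have q0 : 0 < q by rewrite sqrtr_gt0.
have q2 : q ^+ 2 = r%:R by rewrite sqr_sqrtr// ltW.
have q1 : 1 <= q by rewrite -sqrtr1 ler_wsqrtr// ler1n.
have E1 := first_moment r0; have E4 := fourth_moment r.
rewrite -/q in E1.
rewrite /step_const -[leRHS]mulrA.
apply: ler_wpM2l; first by rewrite mulr_ge0 ?exprn_ge0.
rewrite [leRHS]mulrDl; apply: lerD.
  apply: (@le_trans _ _ ((1 + 2 * m%:R) / r%:R ^+ 2 * (2 * m%:R * q))).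
    apply: ler_wpM2l.
      by apply: divr_ge0; [rewrite addr_ge0 ?mulr_ge0|exact: exprn_ge0].
    have mq : m%:R <= m%:R * q by rewrite ler_peMr// ltW.
    by lra.
  rewrite -q2 le_eqVlt; apply/orP; left; apply/eqP; field.
  by rewrite gt_eqF.
apply: (@le_trans _ _ (96 * m%:R ^+ 4 / r%:R ^+ 4 * (8 * m%:R * r%:R ^+ 2))).
  apply: ler_wpM2l; last exact: E4.
  by apply: divr_ge0; [rewrite mulr_ge0 ?exprn_ge0|exact: exprn_ge0].
have -> : 96 * m%:R ^+ 4 / r%:R ^+ 4 * (8 * m%:R * r%:R ^+ 2) =
   96 * (8 * m%:R ^+ 5) / (r%:R * r%:R) :> R by field; rewrite gt_eqF.
rewrite ler_wpM2l ?mulr_ge0 ?exprn_ge0// lef_pV2 ?posrE ?mulr_gt0//.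
by rewrite ler_pM2l// -q2 expr2 ler_peMr// ltW.
Qed.

(** With x and y the two roots, x^-1 - y^-1 = 1 / (x y (x + y)), and y <= 2x bounds the denominator
    by 6 x^3. *)
Lemma inv_sqrt_telescope r : (0 < r)%N ->
  (r%:R * Num.sqrt r%:R)^-1 <=
  6 * ((Num.sqrt r%:R)^-1 - (Num.sqrt r.+1%:R)^-1) :> R.
Proof.
move=> r0; set x := Num.sqrt r%:R; set y := Num.sqrt r.+1%:R.
have x0 : 0 < x by rewrite sqrtr_gt0 ltr0n.
have y0 : 0 < y by rewrite sqrtr_gt0 ltr0n.
have x2 : x ^+ 2 = r%:R by rewrite sqr_sqrtr.
have y2 : y ^+ 2 = x ^+ 2 + 1 by rewrite x2 natr1 sqr_sqrtr.
have x1 : 1 <= x by rewrite -sqrtr1 ler_wsqrtr// ler1n.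
rewrite -x2.
have -> : 6 * (x^-1 - y^-1) = 6 / (x * y * (x + y)).
  have -> : x^-1 - y^-1 = (y ^+ 2 - x ^+ 2) / (x * y * (x + y)).
    by field; rewrite !gt_eqF// addr_gt0.
  by rewrite y2; field; rewrite !gt_eqF// addr_gt0.
have xy : y <= 2 * x.
  have x21 : 1 <= x ^+ 2 by rewrite x2 ler1n.
  have : y ^+ 2 <= (2 * x) ^+ 2 by rewrite y2 exprMn; lra.
  by rewrite ler_pXn2r// nnegrE; lra.
rewrite -[X in X <= _]mul1r ler_pdivrMr ?mulr_gt0// mulrAC ler_pdivlMr ?mulr_gt0 ?addr_gt0//.
rewrite mul1r (_ : 6 * (x ^+ 2 * x) = x * (2 * x) * (3 * x)); last by ring.
have xy1 : x * y <= x * (2 * x) by rewrite ler_pM2l.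
by apply: ler_pM; [exact/ltW/mulr_gt0|exact/ltW/addr_gt0|exact: xy1|lra].
Qed.

(** One-step errors add up without growing, because the averaged steps preserve the bound 1 on the
    test function. *)
Lemma Ex_corrected_iterK s n h : (m <= s)%N -> (forall l, `|h l| <= 1) ->
  `|Ex (s + n) (corrected (s + n) h) - Ex s (corrected s (iterK s n h))| <=
  6 * step_const * ((Num.sqrt s%:R)^-1 - (Num.sqrt (s + n)%:R)^-1).
Proof.
move=> ms h1; elim: n s ms => [|n IH] s ms.
  by rewrite addn0 !subrr normr0 mulr0.
have s0 : (0 < s)%N by exact: leq_trans ms.
rewrite -addSnnS; have := IH _ (leqW ms).
have hs : forall l, `|iterK s.+1 n h l| <= 1 by apply: iterK_norm_le => //; exact: leqW.
have := Ex_corrected_step ms hs; have := ler_wpM2l step_const_ge0 (inv_sqrt_telescope s0).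
rewrite -[iterK s n.+1 h]/(stepK s (iterK s.+1 n h)).
set a := Ex (s.+1 + n) _; set b := Ex s.+1 _; set c := Ex s _ => e1 e2 e3.
have := ler_distD b a c; lra.
Qed.

Lemma Ex_corrector t h : (0 < t)%N -> (forall l, `|h l| <= 1) ->
  `|Ex t (fun s => h s.1) - Ex t (corrected t h)| <=
  2 * m%:R ^+ 2 / Num.sqrt t%:R.
Proof.
move=> t0 h1; have bh : bnd h by exists 1.
have bl := lbnd_labels bh; have bc := lbnd_corrected t bh.
have m0 := mR_gt0; have t0' : 0 < t%:R :> R by rewrite ltr0n.
have l1 := lbnd_dev (fun x => `|x|) t.
rewrite -mulN1r -ExZ// -ExD//; last exact: lbndZ.
apply: (@le_trans _ _ (Ex t (fun s => (2 * m%:R / t%:R) * \sum_i `|dev t s.2 i|))).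
  apply: Ex_norm_le; [by auto|by auto|move=> s _].
  rewrite /corrected mulN1r opprB addrC subrK normrM ger0_norm ?divr_ge0//.
  rewrite [2 * m%:R / _](_ : _ = m%:R / t%:R * 2); last by ring.
  rewrite -mulrA ler_pM2l ?divr_gt0// mulr_sumr.
  rewrite (le_trans (ler_norm_sum _ _ _))// ler_sum// => i _.
  by rewrite normrM mulrC ler_wpM2r// -[leRHS]mulr1 gain_norm_le.
rewrite ExZ//; set q := Num.sqrt _; have q0 : 0 < q by rewrite sqrtr_gt0.
have q2 : q ^+ 2 = t%:R by rewrite sqr_sqrtr// ltW.
apply: (@le_trans _ _ (2 * m%:R / t%:R * (m%:R * q))).
  apply: ler_wpM2l; last exact: first_moment.
  by apply: divr_ge0 => //; exact: mulr_ge0.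
rewrite -q2 le_eqVlt; apply/orP; left; apply/eqP; field.
by rewrite gt_eqF.
Qed.

(** The telescoped step errors, plus the cost 2 m^2 of removing the corrector at each of the two
    times. *)
Definition mix_const : R := 6 * step_const + 4 * m%:R ^+ 2.

Lemma Ex_iterK s n h : (m <= s)%N -> (forall l, `|h l| <= 1) ->
  `|Ex (s + n) (fun s => h s.1) - Ex s (fun s' => iterK s n h s'.1)| <=
  mix_const / Num.sqrt s%:R.
Proof.
move=> ms h1; have s0 : (0 < s)%N by exact: leq_trans ms.
have hs := iterK_norm_le n ms h1.
have sn0 : (0 < s + n)%N by rewrite addn_gt0 s0.
have := Ex_corrector sn0 h1; have := Ex_corrector s0 hs.
have := Ex_corrected_iterK n ms h1.
set x := Num.sqrt s%:R; set y := Num.sqrt (s + n)%:R.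
have x0 : 0 < x by rewrite sqrtr_gt0 ltr0n.
have xy : y^-1 <= x^-1.
  by rewrite lef_pV2 ?posrE ?sqrtr_gt0 ?ltr0n// ler_wsqrtr// ler_nat leq_addr.
have y0 : 0 <= y^-1 by rewrite invr_ge0 sqrtr_ge0.
set a := Ex _ _; set b := Ex _ _; set c := Ex _ (fun _ => _); set d := Ex _ (fun _ => _).
rewrite (distrC c) => e1 e2 e3.
have := ler_distD a d c; have := ler_distD b a c; have := ler_distD a d b.
rewrite /mix_const => f1 f2 f3.
have k0 := step_const_ge0; have m2 := sqr_ge0 (m%:R : R).
have g1 := ler_wpM2l m2 xy; have g2 := mulr_ge0 k0 y0.
by lra.
Qed.

(** * The limit design *)

Lemma inv_sqrt_small (K e : R) : 0 <= K -> 0 < e ->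
  exists N, forall t, (N <= t)%N -> (0 < t)%N /\ K / Num.sqrt t%:R <= e.
Proof.
move=> K0 e0; exists (Num.bound ((K / e) ^+ 2)).+1 => t Nt.
have t0 : (0 < t)%N by exact: leq_ltn_trans Nt.
split => //; have q0 : 0 < Num.sqrt t%:R :> R by rewrite sqrtr_gt0 ltr0n.
have Ke0 : 0 <= K / e by apply: divr_ge0 => //; exact: ltW.
rewrite ler_pdivrMr// mulrC -ler_pdivrMr// -(ger0_norm Ke0) -sqrtr_sqr.
apply: ler_wsqrtr; apply: (@le_trans _ _ (Num.bound ((K / e) ^+ 2))%:R).
  by apply/ltW/archi_boundP; exact: sqr_ge0.
by rewrite ler_nat (leq_trans _ Nt).
Qed.

Lemma mix_const_ge0 : 0 <= mix_const.
Proof.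
apply: addr_ge0; first by apply: mulr_ge0 => //; exact: step_const_ge0.
by apply: mulr_ge0 => //; exact: sqr_ge0.
Qed.

Lemma cvg_Ex_labels h : (forall l, `|h l| <= 1) -> sym h ->
  cvgn (fun t => Ex t (fun s => h s.1)).
Proof.
move=> h1 sh; have bh : bnd h by exists 1.
apply/cauchy_cvgP; apply: cauchy_exP => e e0.
have e4 : 0 < e / 4 by exact: divr_gt0.
have [N hN] := inv_sqrt_small mix_const_ge0 e4.
(* Large enough for the comparison error, the maximum principle and the contraction at once. Only
   then is [n0] chosen, depending on s; two comparisons and one oscillation, each at most e/4, stay
   below e. *)
pose s := (N + m + Num.bound rate_bound)%N.
have Ns : (N <= s)%N by rewrite /s -addnA leq_addr.
have ms : (m <= s)%N by rewrite /s addnAC leq_addl.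
have rs : rate_bound <= s%:R.
  have r0 : 0 <= rate_bound.
    have iV : 0 < slack^-1 by rewrite invr_gt0 slack_gt0.
    by rewrite /rate_bound; have := mR_gt0; lra.
  rewrite (le_trans (ltW (archi_boundP r0)))// ler_nat.
  by rewrite /s leq_addl.
have [s0 sN] := hN s Ns.
have [n0 osc] := iterK_mixing bh sh rs e4.
exists (Ex (s + n0) (fun s => h s.1)); exists (s + n0)%N => // t /= st.
have -> : t = (s + (n0 + (t - (s + n0))))%N by rewrite addnA subnKC.
set n1 := (t - _)%N; rewrite /ball/=.
have := Ex_iterK n0 ms h1; have := Ex_iterK (n0 + n1) ms h1.
have := iterK_osc n1 ms bh osc => osc1.
have b1 := lbnd_labels (bnd_iterK s n0 bh).
have b2 := lbnd_labels (bnd_iterK s (n0 + n1) bh).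
have : `|Ex s (fun s' => iterK s (n0 + n1) h s'.1) -
         Ex s (fun s' => iterK s n0 h s'.1)| <= e / 4.
  rewrite -mulN1r -ExZ// -ExD//; last exact: lbndZ.
  rewrite -[leRHS](Ex_cst s); apply: Ex_norm_le; [by auto|by auto|move=> s' _].
  by rewrite mulN1r.
set a := Ex (s + n0) _; set b := Ex (s + _) _.
set c := Ex s _; set d := Ex s _ => f1 f2 f3.
have := ler_distD d a b; have := ler_distD c d b.
by rewrite (distrC d c) (distrC c b); lra.
Qed.

(** The counts are a dummy argument, as [uss_labels] reads only the labels. *)
Definition labels l : {fset nat} := uss_labels (l, fun=> 0%N).

Lemma mem_labels l x : (x \in labels l) = ~~ fresh l x.
Proof.
rewrite negb_forall; apply/idP/existsP => [|[i]].
  rewrite in_fset/= mem_pmap map_id => /mapP[i _ lx].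
  by exists i; rewrite negbK lx.
rewrite negbK => /eqP li; rewrite in_fset/= mem_pmap map_id.
by apply/mapP; exists i => //; rewrite mem_enum.
Qed.

Lemma labels_perm (s : {perm 'I_m}) l : labels (fun i => l (s i)) = labels l.
Proof. by apply/fsetP => x; rewrite !mem_labels fresh_perm. Qed.

Lemma card_labels l : inj_labels l -> (forall i, l i != None) -> #|` labels l| = m.
Proof.
move=> il nl; pose u i := odflt 0%N (l i).
have lu i : l i = Some (u i) by rewrite /u; have := nl i; case: (l i).
have -> : labels l = [fset u i | i in 'I_m]%fset.
  apply/fsetP => x; rewrite mem_labels negb_forall.
  apply/existsP/imfsetP => [[i]|[i _ ->]].
    by rewrite negbK lu => /eqP[<-]; exists i.
  by exists i; rewrite negbK lu.
rewrite card_imfset/=; first by rewrite -cardE card_ord.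
by move=> i j uij; apply: (il i j (u i)); rewrite lu// uij.
Qed.

Definition ind (Q : pred {fset nat}) l : R := (Q (labels l))%:R.

Lemma ind_norm_le1 Q l : `|ind Q l| <= 1.
Proof. by rewrite /ind; case: (Q _); rewrite ?normr1// normr0. Qed.

Lemma sym_ind Q : sym (ind Q).
Proof. by move=> s l; rewrite /ind labels_perm. Qed.

Lemma lbnd_ind Q : lbnd (fun s => ind Q s.1).
Proof. by apply: lbnd_labels; exists 1 => l; exact: ind_norm_le1. Qed.
Hint Resolve lbnd_ind : core.

Lemma uss_prob_labelsE t A :
  uss_prob_labels m p t A = Ex t (fun s => ind (pred1 A) s.1).
Proof.
congr (iter _ _ _ _); apply/funext => -[l c].
by rewrite /ind/= -[labels l]/(uss_labels (l, c)); case: (_ == A).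
Qed.

Definition limit_design (A : {fset nat}) : R :=
  limn (fun t => uss_prob_labels m p t A).

Lemma cvg_limit_design A :
  (fun t => uss_prob_labels m p t A) @ \oo --> limit_design A.
Proof.
rewrite /limit_design (funext (uss_prob_labelsE ^~ A)).
by apply: cvg_Ex_labels; [exact: ind_norm_le1|exact: sym_ind].
Qed.

Lemma limit_design_ge0 A : 0 <= limit_design A.
Proof.
apply: limr_ge; first exact: cvgP (@cvg_limit_design A).
apply: nearW => t; rewrite uss_prob_labelsE -(Ex_cst t 0).
by apply: Ex_le.
Qed.

(** * Unbiased estimates and expected samples *)

Definition oapply (u : nat -> R) o : R := if o is Some x then u x else 0.

Lemma oapply_norm_le u C o : 0 <= C -> (forall x, `|u x| <= C) -> `|oapply u o| <= C.
Proof. by move=> C0 uC; case: o => //=; rewrite normr0. Qed.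

Lemma bnd_oapply u i : bnd u -> bnd (fun l => oapply u (l i)).
Proof.
move=> [C uC]; have C0 : 0 <= C by exact: le_trans (uC 0%N).
by exists C => l; exact: oapply_norm_le.
Qed.

Lemma lbnd_estimate u : bnd u -> lbnd (fun s => \sum_i (s.2 i)%:R * oapply u (s.1 i)).
Proof.
move=> bu c; apply: bnd_sum => i; apply: bndM; last exact: bnd_oapply i bu.
by exists `|(c i)%:R|.
Qed.

Lemma lbnd_sample u : bnd u -> lbnd (fun s => \sum_i oapply u (s.1 i)).
Proof. by move=> bu c; apply: bnd_sum => i; exact: bnd_oapply i bu. Qed.

(** A fresh item x relabels a bin of new count N + 1 with probability 1/(N + 1), moving N + 1 units
    of weight from the old label to x. On average one unit moves, which transfers the increment just
    credited to the old label to x. *)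
Lemma op_estimate u l c : bnd u -> inj_labels l ->
  uss_op p (fun s => \sum_i (s.2 i)%:R * oapply u (s.1 i)) (l, c) =
  \sum_i (c i)%:R * oapply u (l i) + mean u.
Proof.
move=> bu il; rewrite uss_op_inj//; last exact: lbnd_estimate.
set f := \sum_i (c i)%:R * oapply u (l i).
pose mu := mean (fun x => (fresh l x)%:R * u x).
have jE i : jump i (fun l => \sum_k (uss_incr c i k)%:R * oapply u (l k)) l =
    (c i).+1%:R * (mu - qfresh l * oapply u (l i)).
  rewrite /mu /qfresh -meanZr// -meanB; [|exact: bndM|exact: bndM].
  rewrite -meanZ; last by bounded.
  congr mean; apply/funext => x; rewrite -sumrB (bigD1 i)//= big1 => [|k ki].
    by rewrite /upd /uss_incr eqxx/=; ring.
  by rewrite /upd (negPf ki) subrr.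
under [X in _ + X]eq_bigr => i _.
  rewrite jE /inv_count mulKf ?pnatr_eq0//; over.
have fE i : \sum_k (uss_incr c i k)%:R * oapply u (l k) = f + oapply u (l i).
  rewrite /f (bigD1 i)//= [in RHS](bigD1 i)//= /uss_incr eqxx -natr1.
  rewrite (eq_bigr (fun k => (c k)%:R * oapply u (l k))); last by move=> k /negPf ->.
  by ring.
under [X in X + _]eq_bigr => i _ do rewrite /= fE.
have -> : mean u = mu + \sum_i popt (l i) * oapply u (l i).
  rewrite (eq_bigr (fun i => mean (fun x => (l i == Some x)%:R * u x))); last first.
    by move=> i _; rewrite mean_pt; case: (l i) => //=; rewrite mul0r.
  rewrite -mean_sum; last by move=> i; exact: bndM.
  rewrite -meanD; [|exact: bndM|by apply: bnd_sum => i; exact: bndM].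
  by congr mean; apply/funext => x; rewrite fresh_inj// -mulr_suml; ring.
rewrite (eq_bigr (fun i => rate l c i * f + (popt (l i) * oapply u (l i) +
    qfresh l * omin c i * oapply u (l i)))); last by move=> i _; rewrite /rate; ring.
rewrite big_split/= -mulr_suml sum_rate// mul1r big_split/=.
rewrite [X in _ + X](eq_bigr (fun i => omin c i * mu -
    qfresh l * omin c i * oapply u (l i))); last by move=> i _; ring.
by rewrite sumrB -mulr_suml sum_omin; ring.
Qed.

Lemma Ex_estimate u t : bnd u ->
  Ex t (fun s => \sum_i (s.2 i)%:R * oapply u (s.1 i)) = t%:R * mean u.
Proof.
move=> bu; have be := lbnd_estimate bu.
elim: t => [|t IH]; first by rewrite mul0r /Ex/= big1// => i _; rewrite mul0r.
rewrite ExS -natr1 mulrDl mul1r -IH -[X in _ + X](Ex_cst t) -ExD//.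
apply: Ex_eq; [exact: lbnd_op|exact: lbndD|].
by move=> [l c] [/= il _ _]; exact: op_estimate.
Qed.

(** Counts are close to t/m, so m/t times the unbiased estimate differs from the plain sum over the
    labels by at most (m/t) sum |dev|, of expected order 1/sqrt t. *)
Lemma cvg_Ex_sample u : (forall x, `|u x| <= 1) ->
  (fun t => Ex t (fun s => \sum_i oapply u (s.1 i))) @ \oo --> m%:R * mean u.
Proof.
move=> u1; have bu : bnd u by exists 1.
have be := lbnd_estimate bu; have bs := lbnd_sample bu.
apply/cvgrPdist_le => e e0.
have [N hN] := inv_sqrt_small (sqr_ge0 (m%:R : R)) e0.
exists N => // t /= Nt; have [t0 ht] := hN t Nt.
apply: le_trans ht; have m0 := mR_gt0; have t0' : 0 < t%:R :> R by rewrite ltr0n.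
have l1 := lbnd_dev (fun x => `|x|) t.
have -> : m%:R * mean u = m%:R / t%:R * (t%:R * mean u).
  by field; rewrite gt_eqF.
rewrite -Ex_estimate// -ExZ// -mulN1r -ExZ// -ExD//; [|exact: lbndZ|exact: lbndZ].
apply: (@le_trans _ _ (Ex t (fun s => m%:R / t%:R * \sum_i `|dev t s.2 i|))).
  apply: Ex_norm_le; [by auto|by auto|move=> s _].
  have -> : m%:R / t%:R * (\sum_i (s.2 i)%:R * oapply u (s.1 i)) +
      -1 * (\sum_i oapply u (s.1 i)) =
      m%:R / t%:R * \sum_i dev t s.2 i * oapply u (s.1 i).
    rewrite mulN1r !mulr_sumr -sumrB; apply: eq_bigr => i _.
    by rewrite /dev; field; rewrite !gt_eqF.
  rewrite normrM ger0_norm ?divr_ge0// ler_pM2l ?divr_gt0//.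
  rewrite (le_trans (ler_norm_sum _ _ _))// ler_sum// => i _.
  by rewrite normrM ler_piMr// oapply_norm_le.
rewrite ExZ//; set q := Num.sqrt _; have q0 : 0 < q by rewrite sqrtr_gt0.
have q2 : q ^+ 2 = t%:R by rewrite sqr_sqrtr// ltW.
apply: (@le_trans _ _ (m%:R / t%:R * (m%:R * q))).
  by rewrite ler_pM2l ?divr_gt0//; exact: first_moment.
rewrite -q2 le_eqVlt; apply/orP; left; apply/eqP; field.
by rewrite gt_eqF.
Qed.

(** A label set of another size forces a bin of count 0, hence of deviation -t/m; by the second
    moment this has probability at most m^3/t. *)
Lemma limit_design_card A : limit_design A != 0 -> #|` A| = m.
Proof.
move=> /eqP pA; apply: contrapT => Am; apply: pA.
apply: cvg_lim => //; apply/cvgrPdist_le => e e0.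
have m0 := mR_gt0.
have [N hN] := inv_sqrt_small (exprn_ge0 3 (ltW m0)) e0.
exists N => // t /= Nt; have [t0 ht] := hN t Nt; have t0' : 0 < t%:R :> R by rewrite ltr0n.
apply: le_trans ht; rewrite sub0r normrN uss_prob_labelsE.
have l2 := lbnd_dev (fun x => x ^+ 2) t.
apply: (@le_trans _ _ (Ex t (fun s => (m%:R / t%:R) ^+ 2 * \sum_i dev t s.2 i ^+ 2))).
  apply: Ex_norm_le; [by auto|by auto|move=> [l c] [/= il nl _]].
  have V0 : 0 <= (m%:R / t%:R) ^+ 2 * \sum_i dev t c i ^+ 2.
    by apply: mulr_ge0; [exact: sqr_ge0|apply: sumr_ge0 => i _; exact: sqr_ge0].
  rewrite /ind/=; case: eqP => [lA|_]; last by rewrite normr0.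
  rewrite normr1; have [i ci] : exists i, c i = 0%N.
    apply: contrapT => /forallNP nc; apply: Am; rewrite -lA card_labels// => i.
    by apply: nl; rewrite lt0n; apply/eqP.
  rewrite (bigD1 i)//= mulrDr ler_wpDr//.
    by apply: mulr_ge0; [exact: sqr_ge0|apply: sumr_ge0 => j _; exact: sqr_ge0].
  rewrite /dev ci le_eqVlt; apply/orP; left; apply/eqP; field.
  by rewrite !gt_eqF.
rewrite ExZ//; set q := Num.sqrt _; have q0 : 0 < q by rewrite sqrtr_gt0.
have q2 : q ^+ 2 = t%:R by rewrite sqr_sqrtr// ltW.
have q1 : 1 <= q by rewrite -sqrtr1 ler_wsqrtr// ler1n.
apply: (@le_trans _ _ ((m%:R / t%:R) ^+ 2 * (m%:R * t%:R))).
  by apply: ler_wpM2l; [exact: sqr_ge0|exact: second_moment].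
have -> : (m%:R / t%:R) ^+ 2 * (m%:R * t%:R) = m%:R ^+ 3 / t%:R :> R.
  by field; rewrite gt_eqF.
by rewrite ler_pM2l ?exprn_gt0// lef_pV2 ?posrE// -q2 expr2 ler_peMr// ltW.
Qed.

Lemma Ex_ind_seq (X : seq {fset nat}) :
  (fun t => Ex t (fun s => \sum_(A <- X) ind (pred1 A) s.1)) @ \oo -->
  \sum_(A <- X) limit_design A.
Proof.
elim: X => [|A X IH].
  rewrite big_nil; apply: cvg_near_cst; apply: nearW => t.
  by rewrite -[RHS](Ex_cst t); congr Ex; apply/funext => s; rewrite big_nil.
have E t : Ex t (fun s => \sum_(B <- A :: X) ind (pred1 B) s.1) =
    uss_prob_labels m p t A + Ex t (fun s => \sum_(B <- X) ind (pred1 B) s.1).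
  rewrite uss_prob_labelsE -ExD//.
    by congr Ex; apply/funext => s; rewrite big_cons.
  by move=> c; apply: bnd_sum => B; exact: lbnd_ind.
rewrite (funext E) big_cons; apply: cvgD => //; exact: cvg_limit_design.
Qed.

Lemma sum_ind_uniq (X : seq {fset nat}) l : uniq X ->
  \sum_(A <- X) ind (pred1 A) l = (labels l \in X)%:R.
Proof.
move=> uX; case: (boolP (labels l \in X)) => [lX|lX].
  rewrite (bigD1_seq (labels l))//= /ind/= eqxx big1 ?addr0// => A Al.
  by rewrite eq_sym (negPf Al).
rewrite big_seq big1// => A AX; rewrite /ind/=.
by case: eqP => // lA; rewrite lA AX in lX.
Qed.

Lemma lbnd_sum_ind (X : seq {fset nat}) :
  lbnd (fun s => \sum_(A <- X) ind (pred1 A) s.1).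
Proof. by move=> c; apply: bnd_sum => A; exact: lbnd_ind. Qed.

Lemma mean_tail n : mean (fun x => (n <= x)%N%:R) = 1 - series p n.
Proof.
rewrite seriesEnat/= big_mkord -[X in X - _]mean_cst.
rewrite (eq_bigr (fun i : 'I_n => mean (fun x => (Some (i : nat) == Some x)%:R))).
  rewrite -mean_sum// -meanB//; last exact: bnd_sum.
  congr mean; apply/funext => x; have [nx|xn] := leqP n x.
    rewrite big1 ?subr0// => i _; case: eqP => // -[ix].
    by have := ltn_ord i; rewrite ix ltnNge nx.
  rewrite (bigD1 (Ordinal xn))//= eqxx big1 ?addr0 ?subrr// => i ix.
  by case: eqP => // -[ix']; case/eqP: ix; apply: val_inj.
by move=> i _; rewrite mean_pt1.
Qed.

(* Tightness: by unbiasedness, the expected number of labels >= n tends to m times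
   the tail of p, so no mass escapes to infinity and sums commute with the limit. *)
Lemma esum_limit_design (Q : pred {fset nat}) a :
  (fun t => Ex t (fun s => ind Q s.1)) @ \oo --> a ->
  \esum_(A in [set A | Q A]) (limit_design A)%:E = a%:E.
Proof.
move=> Qa; apply/eqP; rewrite eq_le; apply/andP; split.
  (* Upper bound: a finite family of sets satisfying Q carries at most the probability of Q at every
     time, and finite sums commute with the limit. *)
  apply: ge_ereal_sup => _ [X [fX XQ] <-].
  rewrite fsumEFin// lee_fin fsbig_finite//=.
  have cX := @Ex_ind_seq (fset_set X).
  rewrite -(cvg_lim _ cX)// -(cvg_lim _ Qa)//; apply: ler_lim.
  - exact: cvgP cX.
  - exact: cvgP Qa.
  - apply: nearW => t; apply: Ex_le; [exact: lbnd_sum_ind|by []|move=> s _].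
    rewrite sum_ind_uniq ?fset_uniq// /ind.
    case: (boolP (_ \in _)) => // lX; rewrite (_ : Q _ = true)//.
    by apply: XQ; move: lX; rewrite in_fset_set// inE.
apply/lee_addgt0Pr => e e0.
have m0 := mR_gt0; have em0 : 0 < e / m%:R by exact: divr_gt0.
have [n _ hn] := (proj1 (cvgrPdist_le _ _) p_sum) _ em0.
have {hn} := hn n (leqnn n); rewrite /= => hn.
pose u x : R := (n <= x)%N%:R.
have u1 x : `|u x| <= 1 by rewrite /u; case: leqP; rewrite ?normr1 ?normr0.
have bu : bnd u by exists 1.
have un : m%:R * mean u <= e.
  rewrite mean_tail mulrC -ler_pdivlMr//.
  by rewrite (le_trans (ler_norm _)).
(* Lower bound: a label set satisfying Q is in this finite family or contains a label >= n, and the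
   latter is counted by the sum of [u] over the bins. *)
pose X := [seq A <- fpowerset [fset x | x in iota 0 n]%fset | Q A].
have uX : uniq X by rewrite filter_uniq// fset_uniq.
have cX := @Ex_ind_seq X; have cu := @cvg_Ex_sample u u1.
have aX : a <= \sum_(A <- X) limit_design A + m%:R * mean u.
  have cXu : (fun t => Ex t (fun s => \sum_(A <- X) ind (pred1 A) s.1) +
      Ex t (fun s => \sum_i oapply u (s.1 i))) @ \oo -->
      \sum_(A <- X) limit_design A + m%:R * mean u.
    by apply: cvgD.
  rewrite -(cvg_lim _ cXu)// -(cvg_lim _ Qa)//; apply: ler_lim.
  - exact: cvgP Qa.
  - exact: cvgP cXu.
  - apply: nearW => t /=; have bX := lbnd_sum_ind X; have bs := lbnd_sample bu.
    apply: (@le_trans _ _ (Ex t (fun s => \sum_(A <- X) ind (pred1 A) s.1 +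
        \sum_i oapply u (s.1 i)))); last by rewrite ExD.
    apply: Ex_le; [by []|exact: lbndD|].
    move=> s _; rewrite sum_ind_uniq//.
    have S0 : 0 <= \sum_i oapply u (s.1 i).
      by apply: sumr_ge0 => i _; case: (s.1 i) => //= x; rewrite /u.
    rewrite /ind; case: (boolP (Q _)) => [Ql|_]; last by rewrite addr_ge0.
    case: (boolP (_ \in X)) => [_|lX]; first by rewrite lerDl.
    rewrite add0r; move: lX; rewrite mem_filter Ql/= fpowersetE => /fsubsetPn[x].
    rewrite mem_labels => /freshN[i li]; rewrite !inE mem_iota/= -leqNgt => nx.
    rewrite (bigD1 i)//= li/= /u nx lerDl sumr_ge0// => j _.
    by case: (s.1 j) => //= y; rewrite /u.
apply: (@le_trans _ _ (\sum_(A <- X) limit_design A + e)%:E).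
  by rewrite lee_fin (le_trans aX)// lerD2l.
rewrite EFinD leeD2r//; apply: esum_ge; exists [set` X].
  split; first exact: finite_seq.
  by move=> A /=; rewrite mem_filter => /andP[].
by rewrite -fsbig_seq// sumEFin.
Qed.

Lemma pps_limit_design : pps_design m p limit_design.
Proof.
split.
- exact: limit_design_ge0.
- rewrite (_ : [set: {fset nat}] = [set A | xpredT A]); last first.
    by apply/seteqP; split.
  apply: esum_limit_design; apply: cvg_near_cst; apply: nearW => t.
  exact: (Ex_cst t 1).
- exact: limit_design_card.
- move=> j; apply: esum_limit_design.
  pose u x : R := (Some j == Some x)%:R.
  have u1 x : `|u x| <= 1 by rewrite /u; case: (_ == _); rewrite ?normr1 ?normr0.
  have bu : bnd u by exists 1.
  have <- : mean u = p j by rewrite /u mean_pt1.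
  (* Labels are distinct, so the number of bins labelled j is the indicator that j belongs to the
     label set. *)
  suff -> : (fun t => Ex t (fun s => ind (fun A => j \in A) s.1)) =
      (fun t => Ex t (fun s => \sum_i oapply u (s.1 i))) by exact: cvg_Ex_sample.
  apply/funext => t; apply: Ex_eq => //; first exact: lbnd_sample.
  move=> [l c] [/= il _ _]; rewrite /ind mem_labels.
  have := fresh_inj j il.
  have -> : \sum_i (l i == Some j)%:R = \sum_i oapply u (l i).
    by apply: eq_bigr => i _; rewrite /u; case: (l i) => //= x; rewrite eq_sym.
  move=> fE; have -> : (~~ fresh l j)%:R = 1 - (fresh l j)%:R :> R.
    by case: (fresh l j); rewrite ?subrr ?subr0.
  by rewrite fE opprB addrC subrK.
Qed.

End UnbiasedSpaceSaving.

Theorem theorem4 (R : realType) (m : nat) (p : nat -> R) :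
  (0 < m)%N ->
  (forall j, 0 <= p j) ->
  (forall j, p j.+1 <= p j) ->
  series p @ \oo --> (1 : R) ->
  p 0%N < (m%:R)^-1 ->
  exists pi : {fset nat} -> R,
    pps_design m p pi /\
    forall A : {fset nat}, (fun t => uss_prob_labels m p t A) @ \oo --> pi A.
Proof.
move=> m_gt0 p_ge0 p_noninc p_sum p0_lt; exists (limit_design p m).
split; first exact: pps_limit_design.
by move=> A; exact: cvg_limit_design.
Qed.
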